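(* Let $\Phi$ be a homogeneous Poisson point process on $\mathbb{R}^2$ with intensity $\lambda>0$. Let $\boldsymbol{x}_{\rm s},\boldsymbol{x}_{\rm d}\in\mathbb{R}^2$ be distinct, $\boldsymbol{w}=\frac{\boldsymbol{x}_{\rm s}+\boldsymbol{x}_{\rm d}}{2}$, $d=\|\boldsymbol{x}_{\rm s}-\boldsymbol{w}\|$, and $\widehat{s}(\boldsymbol{x})=\max\{\|\boldsymbol{x}_{\rm s}-\boldsymbol{x}\|,\|\boldsymbol{x}-\boldsymbol{x}_{\rm d}\|\}$. Let $\boldsymbol{X}_{\rm mid}$ be the point of $\Phi$ closest to $\boldsymbol{w}$ and $\boldsymbol{X}_{\rm opt}$ the point of $\Phi$ minimizing $\widehat{s}$ over $\Phi$. For $\boldsymbol{x}\in\mathbb{R}^2$ with norm $\psi$ and angle $\theta\in[0,\frac{\pi}{2}]$ (polar coordinates as specified in the context), define $$P(\boldsymbol{x})=\left(\widehat{s}(\boldsymbol{x})^2-\psi^2\right)(\pi-2\theta)-d^2\sin(2\theta)-V(\boldsymbol{x},d)+V(\boldsymbol{x},d\sin\theta),$$ where $$V(\boldsymbol{x},y)=2y\sqrt{\widehat{s}(\boldsymbol{x})^2-y^2}+2\,\widehat{s}(\boldsymbol{x})^2\arctan\left(\frac{y}{\sqrt{\widehat{s}(\boldsymbol{x})^2-y^2}}\right).$$ Then $$\mathsf{Pr}\{\boldsymbol{X}_{\rm mid}=\boldsymbol{X}_{\rm opt}\}=4\,\mathsf{E}\left[\exp\left(-\lambda P(\boldsymbol{X}_{\rm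 mid})\right)\mathbf{1}_{\{0\le\Theta_{\rm mid}\le\frac{\pi}{2}\}}\right],$$ where $\Theta_{\rm mid}\in[0,2\pi)$ is the angle of $\boldsymbol{X}_{\rm mid}$.
   Context: $\|\cdot\|$ is the Euclidean norm; $\mathbf{1}_{\{\cdot\}}$ is an indicator function. Polar coordinates are centered at the mid-point $\boldsymbol{w}$: the norm of a point $\boldsymbol{x}$ is $\psi=\|\boldsymbol{x}-\boldsymbol{w}\|$, and its angle is measured from the direction of $\boldsymbol{x}_{\rm d}-\boldsymbol{w}$ (equivalently, one uses coordinates in which $\boldsymbol{x}_{\rm s}=(-d,0)^\top$, $\boldsymbol{x}_{\rm d}=(d,0)^\top$, $\boldsymbol{w}=\boldsymbol{0}$). The points $\boldsymbol{X}_{\rm mid}$ and $\boldsymbol{X}_{\rm opt}$ are almost surely unique. *)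

(* Defs.v *)
From mathcomp Require Export all_boot all_order all_algebra.
From mathcomp Require Export all_classical all_reals all_analysis.
From mathcomp Require Import finmap.
Export Order.TTheory GRing.Theory Num.Theory.
Export numFieldNormedType.Exports.

Set Implicit Arguments.
Unset Strict Implicit.
Unset Printing Implicit Defensive.

Local Open Scope classical_set_scope.
Local Open Scope ring_scope.

Section Plane.
Context {R : realType}.
Implicit Types x y xs xd : R * R.

(* The library norm on [R * R] is the maximum norm, hence this definition. *)
Definition enorm x : R := Num.sqrt (x.1 ^+ 2 + x.2 ^+ 2).

Definition midpoint x y : R * R := ((x.1 + y.1) / 2, (x.2 + y.2) / 2).

Definition half_dist xs xd : R := enorm (xs - midpoint xs xd).

Definition shat xs xd x : R := Num.max (enorm (xs - x)) (enorm (x - xd)).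

(* Cartesian coordinates of [x] in the direct orthonormal frame with origin
   [midpoint xs xd] and first axis directed towards [xd]; in these coordinates
   [xs] is (-d, 0) and [xd] is (d, 0), with [d = half_dist xs xd]. *)
Definition frame_coords xs xd x : R * R :=
  let u := x - midpoint xs xd in
  let e := xd - midpoint xs xd in
  let d := half_dist xs xd in
  ((u.1 * e.1 + u.2 * e.2) / d, (e.1 * u.2 - e.2 * u.1) / d).

Definition polar_norm xs xd x : R := enorm (x - midpoint xs xd).

(* Unique as soon as [x] differs from the origin [midpoint xs xd] (and
   [xs <> xd]); at the origin, an unspecified element of [0, 2 pi). *)
Definition polar_angle xs xd x : R :=
  get [set t | 0 <= t < 2 * pi /\
    frame_coords xs xd x =
      (polar_norm xs xd x * cos t, polar_norm xs xd x * sin t)].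

Definition V_fun xs xd x (y : R) : R :=
  let s := shat xs xd x in
  2 * y * Num.sqrt (s ^+ 2 - y ^+ 2)
  + 2 * s ^+ 2 * atan (y / Num.sqrt (s ^+ 2 - y ^+ 2)).

(* Meant for [polar_angle xs xd x] in [0, pi / 2] only. *)
Definition P_fun xs xd x : R :=
  let s := shat xs xd x in
  let d := half_dist xs xd in
  let psi := polar_norm xs xd x in
  let theta := polar_angle xs xd x in
  (s ^+ 2 - psi ^+ 2) * (pi - 2 * theta) - d ^+ 2 * sin (2 * theta)
  - V_fun xs xd x d + V_fun xs xd x (d * sin theta).

Definition area : set (R * R) -> \bar R :=
  (@lebesgue_measure R \x @lebesgue_measure R)%E.

End Plane.

Definition is_argmin (R : realType) (T : Type) (f : T -> R) (A : set T)
    (x : T) : Prop :=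
  A x /\ forall y, A y -> f x <= f y.

Section PoissonProcess.
Context {R : realType} {d : measure_display} {Omega : measurableType d}.

(* A simple point process is represented by the random set of its points. *)
Definition npoints (Phi : Omega -> set (R * R)) (B : set (R * R))
    (omega : Omega) : nat :=
  #|` fset_set (Phi omega `&` B) |.

(* The second argument of [poisson_prob] is a dummy;
   [poisson_prob 0 _] is the Dirac mass at 0. *)
Definition homogeneous_PPP (P : probability Omega R) (lambda : R)
    (Phi : Omega -> set (R * R)) : Prop :=
  [/\ forall omega (B : set (R * R)), bounded_set B ->
        finite_set (Phi omega `&` B),
      forall B : set (R * R), bounded_set B -> measurable B ->
        measurable_fun [set: Omega] (npoints Phi B),
      forall (B : set (R * R)) (K : set nat), bounded_set B -> measurable B ->
        P (npoints Phi B @^-1` K) =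
        poisson_prob (lambda * fine (area B)) 0%N K
    & forall (n : nat) (B : 'I_n -> set (R * R)) (K : 'I_n -> set nat),
        (forall i, bounded_set (B i)) -> (forall i, measurable (B i)) ->
        trivIset [set: 'I_n] B ->
        P (\bigcap_i (npoints Phi (B i) @^-1` K i)) =
        (\prod_i P (npoints Phi (B i) @^-1` K i))%E].

End PoissonProcess.

(* Main.v *)
(* The plane is cut by the level sets of r = |x - w|^2 and
   s = shat(x)^2 into cells {a <= r < a + t, b <= s < b + t}. Up to a factor
   exp(O(t)) uniform over the cells, complete independence gives

     P(Xmid = Xopt, Xmid in C) = P(Xmid in C') exp(- lambda area(D))

   for Borel parts C, C' of equal area of one cell, where D is the region
   {s < b, r >= a + t} that must be empty and where area(D) is close to
   a(x) = area {y | s y < s x, r x <= r y} for x in the cell. Summing over the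
   cells and letting t go to 0 yields, without Palm calculus,

     P(Xmid = Xopt, Xmid in Q) = E[exp(- lambda a(Xmid)); Xmid in Q']

   whenever Q and Q' meet all cells in equal areas. Each of the four quadrants
   can be taken for Q, and the first one for Q', hence the factor 4. Finally,
   a(x) = P(x): in frame coordinates a vertical slice of the region
   {s y < s x, r x <= r y} at abscissa u has length
   2 (sqrt (shat^2 - (|u| + d)^2) - sqrt (psi^2 - u^2)) if
   |u| < psi cos theta, and is empty otherwise. *)
From HB Require Import structures.
From mathcomp Require Import finmap.
Require Import Defs.
From mathcomp Require Import measurable_realfun ring lra.

Set Implicit Arguments.
Unset Strict Implicit.
Unset Printing Implicit Defensive.

Local Open Scope classical_set_scope.
Local Open Scope ring_scope.

(** * Lebesgue measure in the plane *)

(** Instead of conditioning on the null event that [Xmid] is at a given place, every estimate bears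
    on the counts in at most four disjoint regions. The law of [Xmid] is never computed: the area of
    a part of a cell enters both sides through the probability of finding a point there, so equal
    areas make it cancel up to exp(O(t)). Errors are kept multiplicative because there are
    infinitely many cells, over which additive errors would require a tail estimate. One factor
    serves all cells because [r] and [s] are squared distances: {a <= r < a + t} has area pi t
    whatever a is, and {b <= s < b + t} is covered by two such annuli, hence the constant 2 pi. With
    unsquared distances these areas would grow with the radius. The midpoint, where the angle is
    unspecified, is avoided by [Xmid] almost surely. *)

Lemma measurable_preimageT d d' (T : measurableType d) (T' : measurableType d')
    (f : T -> T') (A : set T') :
  measurable_fun setT f -> measurable A -> measurable (f @^-1` A).
Proof. by move=> mf mA; rewrite -[X in measurable X]setTI; exact: mf. Qed.

Section PlaneMeasure.
Context {R : realType}.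
Let mu : {sigma_finite_measure set (measurableTypeR R) -> \bar R} :=
  @lebesgue_measure R.

HB.instance Definition _ := isMeasure.Build _ (R * R)%type R (@area R)
  (measure0 (mu \x mu)%E) (measure_ge0 (mu \x mu)%E)
  (@measure_semi_sigma_additive _ _ _ (mu \x mu)%E).
(** Makes [area] itself, not only the product it unfolds to, a measure whose sections depend
    measurably on the point; see [measurable_void_prob]. *)
Let sf : sigma_finite [set: R*R] (@area R).
Proof.
have /sigma_finiteP[F [TF ndF Foo]] := sigma_finiteT mu.
exists (fun n => F n `*` F n).
  rewrite -setXTT TF predeqE => -[x y]; split.
    move=> [/= [n _ Fnx] [k _ Gky]]; exists (maxn n k) => //; split.
    - by move: x Fnx; exact/subsetPset/ndF/leq_maxl.
    - by move: y Gky; exact/subsetPset/ndF/leq_maxr.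
  by move=> [n _ []/= ? ?]; split; exists n.
move=> k; have [? ?] := Foo k.
split; first exact: measurableX.
by rewrite /area product_measure1E// lte_mul_pinfty// ge0_fin_numE.
Qed.
HB.instance Definition _ := Measure_isSigmaFinite.Build _ (R * R)%type R (@area R) sf.

Lemma lebesgue_measure_translation (a : R) (A : set R) : measurable A ->
  lebesgue_measure [set x | A (x + a)] = lebesgue_measure A.
Proof.
move=> mA.
pose f (x : measurableTypeR R) : measurableTypeR R := x + a.
have mf : measurable_fun [set: measurableTypeR R] f by exact: measurable_funD.
apply/esym/(@lebesgue_measure_unique R (pushforward mu f)) => //= _ [[u v]] _ <- /=.
rewrite /pushforward /=.
rewrite [X in _ = _ X](_ : _ = `]u - a, v - a]%classic); last first.
  by apply/seteqP; split => x /=; rewrite !in_itv/= ltrBlDr lerBrDr.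
rewrite !lebesgue_measure_itv/= !lte_fin ltrD2r; case: ifP => // _.
by rewrite -!EFinD; congr (_ %:E); rewrite opprB addrA subrK.
Qed.

Lemma areaE A :
  @area R A = (\int[lebesgue_measure]_x lebesgue_measure (xsection A x))%E.
Proof. by []. Qed.

(** Integration in the other order agrees with [area] on rectangles, hence on all measurable sets by
    uniqueness of the product measure. *)
Lemma areaE2 (A : set (R * R)) : measurable A ->
  @area R A = (\int[lebesgue_measure]_y lebesgue_measure (ysection A y))%E.
Proof.
move=> mA.
apply: (@product_measure_unique _ _ (measurableTypeR R) (measurableTypeR R) R
  mu mu (mu \x^ mu)%E) => //.
by move=> B C mB mC; exact: (product_measure2E mu mu).
Qed.


(** A vertical shear translates each vertical section, which allows an arbitrary [phi]; the
    horizontal one goes through [areaE2], where the sheared set has to be measurable. *)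
Lemma area_vshear (phi : R -> R) (A : set (R * R)) :
  measurable A -> area [set x | A (x.1, x.2 + phi x.1)] = area A.
Proof.
move=> mA; rewrite !areaE; apply: eq_integral => x _.
rewrite -[RHS](lebesgue_measure_translation (phi x)).
  by congr lebesgue_measure; apply/seteqP; split => y /=; rewrite /xsection/= !inE.
exact: measurable_xsection.
Qed.

Lemma area_hshear (phi : R -> R) (A : set (R * R)) :
  measurable_fun setT phi ->
  measurable A -> area [set x | A (x.1 + phi x.2, x.2)] = area A.
Proof.
move=> mphi mA.
have mshear : measurable_fun setT (fun x : R * R => (x.1 + phi x.2, x.2)).
  apply: measurable_fun_pair => //; apply: measurable_funD => //.
  exact: measurableT_comp.
rewrite (areaE2 mA) areaE2; last exact: measurable_preimageT mshear mA.
apply: eq_integral => x _.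
rewrite -[RHS](lebesgue_measure_translation (phi x)).
  by congr lebesgue_measure; apply/seteqP; split => y /=; rewrite /ysection/= !inE.
exact: measurable_ysection.
Qed.

Lemma area_Nsnd (A : set (R * R)) :
  measurable A -> area [set x : R * R | A (x.1, - x.2)] = area A.
Proof.
move=> mA; rewrite !areaE; apply: eq_integral => x _.
rewrite -[RHS]lebesgue_measureN; last exact: measurable_xsection.
by congr lebesgue_measure; apply/seteqP; split => y /=; rewrite /xsection/= !inE.
Qed.

Lemma area_Nfst (A : set (R * R)) :
  measurable A -> area [set x : R * R | A (- x.1, x.2)] = area A.
Proof.
move=> mA.
have mN : measurable_fun setT (fun x : R * R => (- x.1, x.2)).
  by apply: measurable_fun_pair => //; exact: measurableT_comp.
rewrite (areaE2 mA) areaE2; last exact: measurable_preimageT mN mA.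
apply: eq_integral => x _.
rewrite -[RHS]lebesgue_measureN; last exact: measurable_ysection.
by congr lebesgue_measure; apply/seteqP; split => y /=; rewrite /ysection/= !inE.
Qed.

Lemma area_translation (a b : R) (A : set (R * R)) :
  measurable A -> area [set x | A (x.1 - a, x.2 - b)] = area A.
Proof.
move=> mA; rewrite -[RHS](area_vshear (fun=> - b) mA).
rewrite -[RHS](area_hshear (phi:=fun=> - a)); [exact: erefl|exact: measurable_cst|].
apply: measurable_preimageT mA; apply: measurable_fun_pair => //.
exact: measurable_funD.
Qed.

Let measurable_lin (a b : R) :
  measurable_fun setT (fun x : R * R => a * x.1 + b * x.2).
Proof. by apply: measurable_funD; exact: measurable_funM. Qed.

(* A rotation of angle different from pi is a product of three shears. *)
Lemma area_rotation (c s : R) (A : set (R * R)) : c ^+ 2 + s ^+ 2 = 1 ->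
  measurable A ->
  area [set x | A (c * x.1 + s * x.2, c * x.2 - s * x.1)] = area A.
Proof.
have shears (c' s' : R) (B : set (R * R)) :
    0 <= c' -> c' ^+ 2 + s' ^+ 2 = 1 -> measurable B ->
    area [set x | B (c' * x.1 + s' * x.2, c' * x.2 - s' * x.1)] = area B.
  (* [t] is the tangent of half the angle: the factors are the horizontal shear [t], the vertical
     shear [- s'] and the horizontal shear [t] again. [0 <= c'] keeps the denominator positive. *)
  move=> c0 cs1 mB; pose t := s' / (1 + c').
  have c1 : 1 + c' != 0 by rewrite gt_eqF// ltr_pwDl.
  have tE : t * (1 + c') = s' by rewrite /t divfK.
  have cE : 1 - t * s' = c'.
    by apply: (mulIf c1); rewrite mulrBl mulrAC tE; lra.
  have mt : measurable_fun setT (fun u : R => t * u) by exact: measurable_funM.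
  have mV : measurable_fun setT (fun x : R * R => (x.1, x.2 + - s' * x.1)).
    apply: measurable_fun_pair => //; apply: measurable_funD => //.
    exact: measurable_funM.
  have mH : measurable_fun setT (fun x : R * R => (x.1 + t * x.2, x.2)).
    apply: measurable_fun_pair => //; apply: measurable_funD => //.
    exact: measurable_funM.
  have mB1 := measurable_preimageT mH mB; have mB2 := measurable_preimageT mV mB1.
  rewrite -[RHS](area_hshear mt mB) -[RHS](area_vshear (fun u => - s' * u) mB1).
  rewrite -[RHS](area_hshear mt mB2).
  congr area; apply/funext => -[x y] /=; congr (B (_, _)).
    transitivity ((1 - t * s') * x + t * (1 + (1 - t * s')) * y); last by ring.
    by rewrite cE tE.
  transitivity ((1 - t * s') * y - s' * x); last by ring.
  by rewrite cE.
(* For [c < 0], the rotation is that of [(- c, - s)] composed with the central symmetry, that is,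
   with both sign changes. *)
move=> cs1 mA; have [c0|c0] := leP 0 c; first exact: shears.
have mR : measurable [set x | A (- c * x.1 + - s * x.2, - c * x.2 - - s * x.1)].
  by apply: measurable_preimageT mA; apply: measurable_fun_pair => //;
    apply: measurable_funB; exact: measurable_funM.
have c0' : 0 <= - c by rewrite oppr_ge0 ltW.
have cs1' : (- c) ^+ 2 + (- s) ^+ 2 = 1 by rewrite !sqrrN.
rewrite -(shears _ _ _ c0' cs1' mA) -[RHS](area_Nfst mR) -[RHS]area_Nsnd; last first.
  apply: measurable_preimageT mR; apply: measurable_fun_pair => //.
  exact: measurable_funN.
by congr area; apply/funext => -[x y] /=; congr (A (_, _)); ring.
Qed.

Lemma measurable_frame_coords (xs xd : R * R) :
  measurable_fun setT (frame_coords xs xd).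
Proof.
apply: measurable_fun_pair; apply: measurable_funM => //.
  by apply: measurable_funD; apply: measurable_funM => //; apply: measurable_funB.
by apply: measurable_funB; apply: measurable_funM => //; apply: measurable_funB.
Qed.

Lemma enormK (x : R * R) : enorm x ^+ 2 = x.1 ^+ 2 + x.2 ^+ 2.
Proof. by rewrite sqr_sqrtr// addr_ge0// sqr_ge0. Qed.

Lemma enorm_ge0 (x : R * R) : 0 <= enorm x.
Proof. exact: sqrtr_ge0. Qed.

Lemma half_dist_gt0 (xs xd : R * R) : xs <> xd -> 0 < half_dist xs xd.
Proof.
move=> xsd; rewrite lt_neqAle enorm_ge0 andbT; apply/eqP => h0; apply: xsd.
have /eqP : half_dist xs xd ^+ 2 = 0 by rewrite -h0 expr0n.
rewrite enormK paddr_eq0 ?sqr_ge0// !sqrf_eq0/= => /andP[/eqP h1 /eqP h2].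
apply: injective_projections; lra.
Qed.

Lemma area_frame_coords (xs xd : R * R) (A : set (R * R)) : xs <> xd ->
  measurable A -> area (frame_coords xs xd @^-1` A) = area A.
Proof.
move=> xsd mA; have d0 := half_dist_gt0 xsd.
set d := half_dist xs xd in d0; pose e := xd - midpoint xs xd.
have ed : (e.1 / d) ^+ 2 + (e.2 / d) ^+ 2 = 1.
  rewrite !expr_div_n -mulrDl (_ : _ + _ = d ^+ 2) ?divff ?gt_eqF ?exprn_gt0//.
  by rewrite enormK /= /e/=; field.
rewrite -[RHS](area_rotation ed mA).
rewrite -[RHS](area_translation (midpoint xs xd).1 (midpoint xs xd).2).
  by congr area; apply/funext => -[x y] /=; congr (A (_, _)) => /=;
    rewrite -/d /e /=; field; rewrite gt_eqF.
apply: measurable_preimageT mA; apply: measurable_fun_pair => //.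
by apply: measurable_funB; exact: measurable_funM.
Qed.

Lemma area_bounded_lty (A : set (R * R)) :
  bounded_set A -> measurable A -> (area A < +oo)%E.
Proof.
move=> /pinfty_ex_gt0[M M0 AM] mA.
have AI : A `<=` `[- M, M]%classic `*` `[- M, M]%classic.
  move=> -[x y] /AM /=; rewrite prod_normE ge_max => /andP[].
  by rewrite !in_itv/= -!ler_norml.
have mI : measurable (`[- M, M] `*` `[- M, M] : set (R * R)).
  exact: measurableX.
apply: (@le_lt_trans _ _
  (area (`[- M, M]%classic `*` `[- M, M]%classic : set (R * R)))).
  by apply: le_measure; rewrite ?inE.
rewrite [area _](@product_measure1E _ _ (measurableTypeR R) (measurableTypeR R)
  R mu mu)//.
rewrite /mu/= lebesgue_measure_itv/=; case: ifP => _; last by rewrite mul0e.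
by rewrite -EFinB -EFinM ltry.
Qed.

Lemma bounded_setW (A B : set (R * R)) :
  A `<=` B -> bounded_set B -> bounded_set A.
Proof.
by move=> AB [M [Mr BM]]; exists M; split => // M' MM' x /AB; exact: BM.
Qed.

Lemma bounded_disc (p : R * R) (r : R) :
  bounded_set [set x : R * R | (x.1 - p.1) ^+ 2 + (x.2 - p.2) ^+ 2 < r].
Proof.
have le1 (a b : R) : (a - b) ^+ 2 < r -> `|a| <= `|b| + (r + 1).
  move=> abr; rewrite -[a](subrK b) addrC (le_trans (ler_normD _ _))// lerD2l.
  (* With z the distance from [a] to [b], this gives 2 z <= z^2 + 1 < r + 1, a bound free of square
     roots and valid for any sign of [r]. *)
  have : 0 <= (`|a - b| - 1) ^+ 2 by exact: sqr_ge0.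
  rewrite sqrrB1 real_normK ?num_real//.
  have := normr_ge0 (a - b); lra.
exists (`|p| + (r + 1)); split; first exact: num_real.
move=> M pM x /= xp; apply: le_trans (ltW pM).
have := sqr_ge0 (x.1 - p.1); have := sqr_ge0 (x.2 - p.2) => x2 x1.
rewrite !prod_normE ge_max; apply/andP; split.
  rewrite (le_trans (le1 _ p.1 _))//; first by lra.
  by rewrite lerD2r le_max lexx.
rewrite (le_trans (le1 _ p.2 _))//; first by lra.
by rewrite lerD2r le_max lexx orbT.
Qed.

End PlaneMeasure.

(** * The area under a circle arc and the crescent *)

Section SqrtIntegral.
Context {R : realType}.
Implicit Types (a b r u : R).

(** Obtained by inverting sine on a segment, so that the endpoints are included: the arc of a full
    disc ends there, where [asin] is not differentiable. *)
Lemma continuous_asin_itv : {within `[(-1)%R : R, 1], continuous asin}.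
Proof.
have le0 : - (pi / 2) <= pi / 2 :> R.
  by have := pi_ge0 R; lra.
have := segment_can_le_continuous le0
  (continuous_subspaceT (@continuous_sin R)) (@sinK R).
by rewrite sinN sin_pihalf.
Qed.

(* The area under the unit semicircle over [0, t]. *)
Definition semicircle_primitive (t : R) : R :=
  (t * Num.sqrt (1 - t ^+ 2) + asin t) / 2.

Lemma continuous_semicircle_primitive :
  {within `[(-1)%R : R, 1], continuous semicircle_primitive}.
Proof.
move=> x; apply: cvgM; last exact: cvg_cst.
apply: cvgD; last exact: continuous_asin_itv.
apply: (@continuous_subspaceT R R `[-1, 1] (fun t => t * Num.sqrt (1 - t ^+ 2))) => y.
apply: cvgM => //; apply: (@continuous_comp _ _ _ (fun t : R => 1 - t ^+ 2) Num.sqrt).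
  by apply: cvgB; [exact: cvg_cst|exact: exprn_continuous].
exact: sqrt_continuous.
Qed.

Lemma is_derive_semicircle_primitive (t : R) : -1 < t < 1 ->
  is_derive t 1 semicircle_primitive (Num.sqrt (1 - t ^+ 2)).
Proof.
move=> t1.
have s0 : 0 < 1 - t ^+ 2.
  case/andP: t1 => ? ?; rewrite (_ : _ - _ = (1 - t) * (1 + t)); last by ring.
  by rewrite mulr_gt0//; lra.
have dq : is_derive t 1 (fun t : R => 1 - t ^+ 2) (- (2 * t)).
  by apply: is_derive_eq; rewrite /GRing.scale /=; ring.
have ds : is_derive t 1 (fun t : R => Num.sqrt (1 - t ^+ 2))
    ((2 * Num.sqrt (1 - t ^+ 2))^-1 * - (2 * t)).
  exact: (@is_derive1_comp _ Num.sqrt (fun t : R => 1 - t ^+ 2) _ _ _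
    (is_derive1_sqrt s0) dq).
have da := is_derive1_asin t1.
have dp : is_derive t 1 (fun t : R => t * Num.sqrt (1 - t ^+ 2))
    (t * ((2 * Num.sqrt (1 - t ^+ 2))^-1 * - (2 * t)) + Num.sqrt (1 - t ^+ 2)).
  by apply: is_derive_eq; rewrite /GRing.scale /=; ring.
have dc : is_derive t 1 semicircle_primitive
    ((t * ((2 * Num.sqrt (1 - t ^+ 2))^-1 * - (2 * t)) + Num.sqrt (1 - t ^+ 2)
      + (Num.sqrt (1 - t ^+ 2))^-1) / 2).
  rewrite /semicircle_primitive; apply: is_derive_eq; by rewrite /GRing.scale /=; ring.
apply: is_derive_eq.
have q0 : Num.sqrt (1 - t ^+ 2) != 0 by rewrite gt_eqF// sqrtr_gt0.
have q2 : Num.sqrt (1 - t ^+ 2) ^+ 2 = 1 - t ^+ 2 by rewrite sqr_sqrtr// ltW.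
apply: (mulIf q0); move: q0 q2; set q := Num.sqrt _ => q0 q2.
transitivity ((q ^+ 2 - t ^+ 2 + 1) / 2); first by field.
by rewrite -expr2 q2; field.
Qed.

Lemma within_continuous_comp_homo (D E : set R) (f g : R -> R) :
  continuous f -> {homo f : x / D x >-> E x} ->
  {within E, continuous g} -> {within D, continuous (g \o f)}.
Proof.
move=> cf fDE /subspace_continuousP cg; apply/subspace_continuousP => x Dx.
apply: cvg_comp (cg _ (fDE _ Dx)) => A /(cf x) fA.
suff : \forall v \near x, D v -> A (f v) by [].
by apply: (@filterS _ (nbhs x) _ _ _ _ fA) => v /= EA /fDE /EA.
Qed.

Lemma within_continuousM (D : set R) (f g : R -> R) :
  {within D, continuous f} -> {within D, continuous g} ->
  {within D, continuous (fun x => f x * g x)}.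
Proof. by move=> cf cg x; apply: cvgM; [exact: cf|exact: cg]. Qed.

Lemma continuous_sqrt_quadratic (r e : R) :
  continuous (fun u : R => Num.sqrt (r ^+ 2 - (u + e) ^+ 2)).
Proof.
move=> u; apply: (@continuous_comp _ _ _ (fun t : R => r ^+ 2 - (t + e) ^+ 2) Num.sqrt).
  apply: cvgB; first exact: cvg_cst.
  apply: (@continuous_comp _ _ _ (fun t : R => t + e) (fun t => t ^+ 2)).
    by apply: cvgD => //; exact: cvg_cst.
  exact: exprn_continuous.
exact: sqrt_continuous.
Qed.

(** The substitution [(u + e) / r] reduces to the unit semicircle. The ends may be zeros of the
    root: the fundamental theorem asks for a derivative on the open interval only, with continuity
    up to the ends. *)
Lemma integral_semicircle (r e a b : R) :
  0 < r -> - r <= a + e -> a <= b -> b + e <= r ->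
  (\int[lebesgue_measure]_(u in `[a, b]) (Num.sqrt (r ^+ 2 - (u + e) ^+ 2))%:E =
   (r ^+ 2 * (semicircle_primitive ((b + e) / r)
     - semicircle_primitive ((a + e) / r)))%:E)%E.
Proof.
move=> r0 ra; rewrite le_eqVlt => /predU1P[<-|ab] br.
  by rewrite subrr mulr0 set_itv1 integral_set1.
have rP (u : R) : u \in `[a, b] -> (u + e) / r \in `[-1, 1].
  rewrite !in_itv/= => /andP[au ub]; rewrite ler_pdivlMr// ler_pdivrMr//.
  by apply/andP; split; lra.
have rP' (u : R) : u \in `]a, b[ -> -1 < (u + e) / r < 1.
  rewrite !in_itv/= => /andP[au ub]; rewrite ltr_pdivlMr// ltr_pdivrMr//.
  by apply/andP; split; lra.
pose l (u : R) := (u + e) / r.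
pose F := fun u : R => r ^+ 2 * semicircle_primitive (l u).
have cl : continuous l.
  by move=> u; apply: cvgM; [apply: cvgD => //; exact: cvg_cst|exact: cvg_cst].
have cF : {within `[a, b], continuous F}.
  apply: (within_continuousM (f := cst (r ^+ 2))).
    by apply: continuous_subspaceT => u; exact: cvg_cst.
  exact: within_continuous_comp_homo cl rP continuous_semicircle_primitive.
have dF (u : R) : u \in `]a, b[ -> is_derive u 1 F (Num.sqrt (r ^+ 2 - (u + e) ^+ 2)).
  move=> uab.
  have dl : is_derive u 1 l r^-1.
    rewrite /l; apply: is_derive_eq; by rewrite /GRing.scale /=; ring.
  have dc : is_derive u 1 (semicircle_primitive \o l) (Num.sqrt (1 - l u ^+ 2) * r^-1).
    exact: (@is_derive1_comp _ semicircle_primitive l _ _ _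
      (is_derive_semicircle_primitive (rP' _ uab)) dl).
  rewrite /F; apply: is_derive_eq; rewrite /GRing.scale /=.
  rewrite (_ : r ^+ 2 - _ = r ^+ 2 * (1 - l u ^+ 2)); last first.
    by rewrite /l; field; rewrite gt_eqF.
  rewrite sqrtrM ?sqr_ge0// sqrtr_sqr gtr0_norm//. by field; rewrite gt_eqF.
rewrite mulrBr EFinB -/(F a) -/(F b).
apply: (continuous_FTC2 ab).
- by apply: continuous_subspaceT => u; exact: continuous_sqrt_quadratic.
- split; first by move=> u /dF[].
    by move/continuous_within_itvP : cF => /(_ ab)[].
  by move/continuous_within_itvP : cF => /(_ ab)[].
- by move=> u /dF H; rewrite derive1E derive_val.
Qed.

(** [Num.sqrt] vanishes on negative numbers, so one formula also covers the slices that miss the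
    region. *)
Lemma lebesgue_measure_sqr_lt (B : R) :
  lebesgue_measure [set v : R | v ^+ 2 < B] = (2 * Num.sqrt B)%:E.
Proof.
have [B0|B0] := ltP 0 B.
  rewrite (_ : [set _ | _] = `]- Num.sqrt B, Num.sqrt B[%classic).
    rewrite lebesgue_measure_itv/= lte_fin gtrN ?sqrtr_gt0// -EFinB.
    by congr (_ %:E); ring.
  apply/seteqP; split => v /=; rewrite in_itv/= -ltr_norml -sqrtr_sqr ltr_sqrt//.
rewrite ler0_sqrtr// mulr0 (_ : [set _ | _] = set0) ?measure0//.
by apply/seteqP; split => v //=; rewrite ltNge (le_trans B0)// sqr_ge0.
Qed.

Lemma measurable_sqr_lt (B : R) : measurable [set v : R | v ^+ 2 < B].
Proof.
apply: open_measurable.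
apply: (open_comp (f := fun v : R => v ^+ 2) (D := [set z | z < B])).
  by move=> v _; exact: exprn_continuous.
exact: open_lt.
Qed.

Lemma lebesgue_measure_sqr_le_lt (A B : R) :
  lebesgue_measure [set v : R | A <= v ^+ 2 < B] =
  (2 * Num.max 0 (Num.sqrt B - Num.sqrt A))%:E.
Proof.
have -> : [set v : R | A <= v ^+ 2 < B] =
    [set v : R | v ^+ 2 < B] `\` [set v : R | v ^+ 2 < A].
  apply/seteqP; split => v /=; rewrite leNgt.
    by case/andP => /negP.
  by case=> -> /negP ->.
have [AB|BA] := leP A B.
  transitivity (lebesgue_measure [set v : R | (v ^+ 2 < B)%R] -
      lebesgue_measure [set v : R | (v ^+ 2 < A)%R])%E.
    rewrite -[X in (_ - lebesgue_measure X)%E](@setIidr _ [set v : R | v ^+ 2 < B]).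
      apply: measureD; [exact: measurable_sqr_lt..|].
      by have := lebesgue_measure_sqr_lt B; rewrite /= => ->; rewrite ltry.
    by move=> v /= /lt_le_trans; exact.
  rewrite !lebesgue_measure_sqr_lt -EFinB max_r ?subr_ge0 ?ler_wsqrtr//.
  by rewrite mulrBr.
rewrite max_l ?subr_le0 ?ler_wsqrtr// 1?ltW// mulr0.
rewrite (_ : _ `\` _ = set0) ?measure0//.
by apply/seteqP; split => v //= -[vB]; apply; apply: lt_trans BA.
Qed.

Lemma measurable_sqrt_quadratic (r e : R) (D : set R) : measurable D ->
  measurable_fun D (fun u : R => Num.sqrt (r ^+ 2 - (u + e) ^+ 2)).
Proof.
move=> mD; apply: measurable_funTS; apply: continuous_measurable_fun => u.
exact: continuous_sqrt_quadratic.
Qed.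

Lemma integral_itv_support (f : R -> R) (a b : R) :
  (forall u, u \notin `[a, b] -> f u = 0) ->
  (\int[lebesgue_measure]_u (f u)%:E =
   \int[lebesgue_measure]_(u in `[a, b]) (f u)%:E)%E.
Proof.
move=> f0; rewrite [RHS]integral_mkcond; apply: eq_integral => u _.
rewrite patchE; case: ifPn => // uab; rewrite f0//; apply: contra uab => uab.
by rewrite inE.
Qed.

Lemma area_disc (p : R * R) (r : R) : 0 <= r ->
  area [set x | (x.1 - p.1) ^+ 2 + (x.2 - p.2) ^+ 2 < r] = (pi * r)%:E.
Proof.
move=> r0; rewrite areaE.
transitivity (\int[lebesgue_measure]_u
    (2 * Num.sqrt (Num.sqrt r ^+ 2 - (u + - p.1) ^+ 2))%:E)%E.
  apply: eq_integral => u _; rewrite sqr_sqrtr// -lebesgue_measure_sqr_lt.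
  rewrite -[RHS](lebesgue_measure_translation (- p.2)); last exact: measurable_sqr_lt.
  by congr lebesgue_measure; apply/seteqP; split => v /=;
    rewrite /xsection/= inE /= ltrBrDr addrC.
have [r1|r1] := ltP 0 r; last first.
  have -> : r = 0 by lra.
  rewrite mulr0; apply: integral0_eq => u _.
  by rewrite ler0_sqrtr ?mulr0// sqrtr0 expr0n/= sub0r oppr_le0 sqr_ge0.
have sr0 : 0 < Num.sqrt r by rewrite sqrtr_gt0.
rewrite (@integral_itv_support _ (p.1 - Num.sqrt r) (p.1 + Num.sqrt r)); last first.
  move=> u; rewrite in_itv/= -ler_distlC => ur.
  rewrite ler0_sqrtr ?mulr0// subr_le0 -(real_normK (num_real (u + _))).
  by rewrite ler_pXn2r ?nnegrE ?(ltW sr0)// distrC ltW// ltNge.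
under eq_integral do rewrite EFinM.
rewrite ge0_integralZl//=; last first.
  by apply/measurable_EFinP; exact: measurable_sqrt_quadratic.
rewrite integral_semicircle//; [|lra..].
rewrite -EFinM; congr (_ %:E).
rewrite (_ : (_ + _ + - p.1) / _ = 1); last by field; rewrite gt_eqF.
rewrite (_ : (_ - _ + - p.1) / _ = -1); last by field; rewrite gt_eqF.
rewrite sqr_sqrtr// /semicircle_primitive sqrrN expr1n subrr sqrtr0 !mulr0 !add0r.
have asin1 : asin (1 : R) = pi / 2.
  rewrite -[X in asin X]sin_pihalf; apply: sinK.
  by rewrite in_itv/= lexx andbT; have := pi_ge0 R; lra.
have asinN1 : asin (- 1 : R) = - (pi / 2).
  rewrite -[X in - X]sin_pihalf -sinN; apply: sinK.
  by rewrite in_itv/= lexx /=; have := pi_ge0 R; lra.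
by rewrite asin1 asinN1; field.
Qed.

(** Both boundary curves pass through [(p, q)], the frame coordinates of the point considered, so
    the slices shrink to nothing at abscissa [p] in absolute value. The factor 4 is 2 for the two
    intervals of a slice times 2 for the sign of the abscissa. *)
Lemma area_crescent (d p q : R) : 0 < d -> 0 <= p -> 0 < p ^+ 2 + q ^+ 2 ->
  let s := Num.sqrt ((p + d) ^+ 2 + q ^+ 2) in
  let psi := Num.sqrt (p ^+ 2 + q ^+ 2) in
  area [set y : R * R | y.1 ^+ 2 + y.2 ^+ 2 + d ^+ 2 + 2 * d * `|y.1| < s ^+ 2 /\
     psi ^+ 2 <= y.1 ^+ 2 + y.2 ^+ 2] =
  (4 * (s ^+ 2 * (semicircle_primitive ((p + d) / s) - semicircle_primitive (d / s))
    - psi ^+ 2 * (semicircle_primitive (p / psi) - semicircle_primitive 0)))%:E.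
Proof.
move=> d0 p0 pq0 s psi.
have s2 : s ^+ 2 = (p + d) ^+ 2 + q ^+ 2 by rewrite sqr_sqrtr// addr_ge0// sqr_ge0.
have psi2 : psi ^+ 2 = p ^+ 2 + q ^+ 2 by rewrite sqr_sqrtr// ltW.
have psi0 : 0 < psi by rewrite sqrtr_gt0.
have s0 : 0 < s.
  have pd0 : 0 < (p + d) ^+ 2 by rewrite exprn_gt0// ltr_wpDl.
  by rewrite sqrtr_gt0 ltr_wpDr// sqr_ge0.
pose G u := Num.max 0
  (Num.sqrt (s ^+ 2 - (`|u| + d) ^+ 2) - Num.sqrt (psi ^+ 2 - (u + 0) ^+ 2)).
have G0 u : 0 <= G u by rewrite le_max lexx.
rewrite areaE.
transitivity (\int[lebesgue_measure]_u (2 * G u)%:E)%E.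
  apply: eq_integral => u _; rewrite -lebesgue_measure_sqr_le_lt.
  congr lebesgue_measure; apply/seteqP; split => v /=;
    rewrite /xsection/= inE /= addr0 sqrrD real_normK ?num_real//.
    move=> [h1 h2]; apply/andP; split; lra.
  move=> /andP[h1 h2]; split; lra.
have cG : continuous G.
  move=> u.
  apply: (@continuous_max R (R : topologicalType) (cst 0) _ u (cvg_cst _)) => /=.
  apply: cvgB; last exact: continuous_sqrt_quadratic.
  apply: (@continuous_comp _ _ _ (fun v : R => `|v|)
    (fun v => Num.sqrt (s ^+ 2 - (v + d) ^+ 2))); first exact: norm_continuous.
  exact: continuous_sqrt_quadratic.
have mG D : measurable D -> measurable_fun D (EFin \o G).
  move=> mD; apply/measurable_EFinP; apply: measurable_funTS.
  exact: continuous_measurable_fun.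
have Gp u : p <= `|u| -> G u = 0.
  move=> pu; apply/max_idPl; rewrite subr_le0 ler_wsqrtr// addr0 s2 psi2.
  rewrite !sqrrD real_normK ?num_real//.
  have : p * d <= `|u| * d by rewrite ler_pM2r.
  lra.
under eq_integral do rewrite EFinM.
rewrite ge0_integralZl//=; [|exact: mG|by move=> u _; rewrite lee_fin].
rewrite ge0_symfun_integralT//; last first.
  by move=> u; rewrite /G /= normrN !addr0 sqrrN.
have -> : (\int[lebesgue_measure]_(x in [set x : R | (0 <= x)%R]) (G x)%:E =
    \int[lebesgue_measure]_(x in `[0%R, p]) (G x)%:E)%E.
  rewrite integral_mkcond [RHS]integral_mkcond; apply: eq_integral => u _.
  rewrite !patchE (_ : (u \in [set x : R | 0 <= x]) = (0 <= u)); last first.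
    by apply/idP/idP; rewrite inE.
  rewrite (_ : (u \in `[0, p]%classic) = (0 <= u <= p)); last first.
    by apply/idP/idP; rewrite inE /= in_itv.
  have [u0|u0]//= := leP 0 u.
  have [//|/ltW up] := leP u p.
  by rewrite Gp// ger0_norm.
have Gle u : u \in `[0, p] ->
    G u = Num.sqrt (s ^+ 2 - (u + d) ^+ 2) - Num.sqrt (psi ^+ 2 - (u + 0) ^+ 2).
  rewrite in_itv/= => /andP[u0 up]; rewrite /G ger0_norm//; apply/max_idPr.
  rewrite subr_ge0 ler_wsqrtr// addr0 s2 psi2 !sqrrD.
  have : u * d <= p * d by rewrite ler_pM2r.
  lra.
have ps : p + d <= s.
  rewrite -(ler_pXn2r (ltn0Sn 1)) ?nnegrE ?(ltW s0)//; last lra.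
  by rewrite s2 lerDl sqr_ge0.
have ppsi : p <= psi.
  by rewrite -(ler_pXn2r (ltn0Sn 1)) ?nnegrE ?(ltW psi0)// psi2 lerDl sqr_ge0.
have Is := integral_semicircle s0 (_ : - s <= 0 + d) p0 ps.
have Ipsi := integral_semicircle psi0 (_ : - psi <= 0 + 0) p0 (_ : p + 0 <= psi).
(* Stated as a sum, since additivity applies to nonnegative integrands; the subtraction is done
   afterwards on finite values. *)
have : (\int[lebesgue_measure]_(x in `[0%R, p]) (G x)%:E +
   \int[lebesgue_measure]_(u in `[0%R, p]) (Num.sqrt (psi ^+ 2 - (u + 0) ^+ 2))%:E =
   \int[lebesgue_measure]_(u in `[0%R, p]) (Num.sqrt (s ^+ 2 - (u + d) ^+ 2))%:E)%E.
  rewrite -ge0_integralD//=.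
  - apply: eq_integral => u; rewrite inE /= => u0p.
    by rewrite Gle// -EFinD subrK.
  - by move=> u _; rewrite lee_fin.
  - exact: mG.
  - by apply/measurable_EFinP; exact: measurable_sqrt_quadratic.
rewrite Is ?Ipsi; [|lra..].
move=> H.
have -> : (\int[lebesgue_measure]_(x in `[0%R, p]) (G x)%:E =
    (s ^+ 2 * (semicircle_primitive ((p + d) / s)
      - semicircle_primitive ((0 + d) / s)))%:E
    - (psi ^+ 2 * (semicircle_primitive ((p + 0) / psi)
      - semicircle_primitive ((0 + 0) / psi)))%:E)%E.
  by rewrite -H addeK.
rewrite -EFinB -!EFinM !add0r !addr0 mul0r; congr (_ %:E); ring.
Qed.
End SqrtIntegral.

(** * The polar form of the area of the crescent *)

Section PolarForm.
Context {R : realType}.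

Lemma cos_sin_atan (a b : R) : 0 < b ->
  cos (atan (a / b)) = b / Num.sqrt (a ^+ 2 + b ^+ 2) /\
  sin (atan (a / b)) = a / Num.sqrt (a ^+ 2 + b ^+ 2).
Proof.
move=> b0; have b2 : 0 < b ^+ 2 by rewrite exprn_gt0.
have cE : cos (atan (a / b)) = b / Num.sqrt (a ^+ 2 + b ^+ 2).
  rewrite cos_atan (_ : 1 + _ = (a ^+ 2 + b ^+ 2) / b ^+ 2); last first.
    by field; rewrite gt_eqF.
  rewrite sqrtrM ?addr_ge0 ?sqr_ge0// sqrtrV ?sqrtr_sqr ?gtr0_norm ?(ltW b2)//.
  by rewrite invfM invrK mulrC.
split=> //; have c0 : cos (atan (a / b)) != 0.
  by rewrite gt_eqF// cos_gt0_pihalf// atan_gtNpi2 atan_ltpi2.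
have := atanK (a / b); rewrite /tan => /(canRL (divfK c0)) ->.
by rewrite cE mulrA divfK// gt_eqF.
Qed.

Lemma semicircle_primitive_sin (x : R) : - (pi / 2) <= x <= pi / 2 ->
  semicircle_primitive (sin x) = (sin x * cos x + x) / 2.
Proof.
move=> xpi; rewrite /semicircle_primitive sinK ?in_itv//.
by rewrite -cos2sin2 sqrtr_sqr ger0_norm// cos_ge0_pihalf.
Qed.

(** The arcsines in the primitives are angles: [asin (p / psi)] is [pi / 2 - th], [asin (d / s)] is
    the arctangent [ga] of [V d], and [asin ((p + d) / s)] is [pi / 2 - (th - al)] with [al] the
    arctangent of [V (d * sin th)]. What remains is a rational identity. *)
Lemma crescent_polarE (d psi th : R) : 0 < d -> 0 < psi -> 0 <= th <= pi / 2 ->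
  let p := psi * cos th in let q := psi * sin th in
  let s := Num.sqrt ((p + d) ^+ 2 + q ^+ 2) in
  let V y := 2 * y * Num.sqrt (s ^+ 2 - y ^+ 2)
    + 2 * s ^+ 2 * atan (y / Num.sqrt (s ^+ 2 - y ^+ 2)) in
  4 * (s ^+ 2 *
      (semicircle_primitive ((p + d) / s) - semicircle_primitive (d / s))
    - psi ^+ 2 * (semicircle_primitive (p / psi) - semicircle_primitive 0)) =
  (s ^+ 2 - psi ^+ 2) * (pi - 2 * th) - d ^+ 2 * sin (2 * th) - V d + V (d * sin th).
Proof.
move=> d0 psi0 /andP[th0 thpi] p q s V.
have pi0 : 0 <= pi :> R := pi_ge0 R.
have c0 : 0 <= cos th by rewrite cos_ge0_pihalf// thpi andbT; lra.
have s0 : 0 <= sin th by rewrite sin_ge0_pi// th0/=; lra.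
have cs1 : cos th ^+ 2 + sin th ^+ 2 = 1 := cos2Dsin2 th.
have p0 : 0 <= p by rewrite mulr_ge0// ltW.
have q0 : 0 <= q by rewrite mulr_ge0// ltW.
have pq : p ^+ 2 + q ^+ 2 = psi ^+ 2 by rewrite /p /q !exprMn -mulrDr cs1 mulr1.
have s2 : s ^+ 2 = (p + d) ^+ 2 + q ^+ 2 by rewrite sqr_sqrtr// addr_ge0// sqr_ge0.
have pd0 : 0 < p + d by rewrite ltr_wpDl.
have psi2 : 0 < psi ^+ 2 by rewrite exprn_gt0.
have dp0 : 0 <= d * p by rewrite mulr_ge0// ltW.
have s0' : 0 < s by rewrite sqrtr_gt0 ltr_pwDl ?sqr_ge0 ?exprn_gt0.
have s2d : 0 < s ^+ 2 - d ^+ 2.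
  by rewrite s2 sqrrD; move: pq psi2 dp0; lra.
pose r := Num.sqrt (s ^+ 2 - d ^+ 2).
have r0 : 0 < r by rewrite sqrtr_gt0.
have r2 : r ^+ 2 = s ^+ 2 - d ^+ 2 by rewrite sqr_sqrtr// ltW.
have t0 : 0 < psi + d * cos th by rewrite ltr_pwDl// mulr_ge0// ltW.
have st : s ^+ 2 = (d * sin th) ^+ 2 + (psi + d * cos th) ^+ 2.
  transitivity (psi ^+ 2 * (cos th ^+ 2 + sin th ^+ 2) + 2 * p * d + d ^+ 2).
    by rewrite s2 /p /q; ring.
  transitivity (psi ^+ 2 + 2 * p * d + d ^+ 2 * (cos th ^+ 2 + sin th ^+ 2)).
    by rewrite cs1 !mulr1.
  by rewrite /p; ring.
have tE : Num.sqrt (s ^+ 2 - (d * sin th) ^+ 2) = psi + d * cos th.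
  by rewrite st [X in X - _]addrC addrK sqrtr_sqr gtr0_norm.
(* In the triangle with vertices (-d, 0), the origin and (p, q), [al] is the angle at (p, q), and
   [th - al] the angle at (-d, 0). *)
pose al := atan (d * sin th / (psi + d * cos th)).
pose ga := atan (d / r).
have [cal sal] := cos_sin_atan (d * sin th) t0.
rewrite -st sqrtr_sqr gtr0_norm// -/al in cal sal.
have [cga sga] := cos_sin_atan d r0.
rewrite r2 addrC subrK sqrtr_sqr gtr0_norm// -/ga in cga sga.
have gapi : - (pi / 2) <= ga <= pi / 2 by rewrite !ltW ?atan_gtNpi2 ?atan_ltpi2.
have al0 : 0 <= al.
  by rewrite -[leLHS]atan0 le_atan// divr_ge0 ?mulr_ge0// ltW.
have alpi : al < pi / 2 by exact: atan_ltpi2.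
have sB : sin (th - al) = q / s.
  by rewrite sinB sal cal /q; field; rewrite gt_eqF.
(* Otherwise [sin (th - al)], which is [q / s], would be negative. This puts [pi / 2 - (th - al)] in
   the range where [asin] inverts [sin]. *)
have alth : al <= th.
  rewrite leNgt; apply/negP => thal.
  have : 0 < sin (al - th) by rewrite sin_gt0_pi//; apply/andP; split; lra.
  rewrite -opprB sinN sB oppr_gt0 ltNge divr_ge0 ?(ltW s0')//.
have bE : sin (pi / 2 - (th - al)) = (p + d) / s.
  rewrite sinB sin_pihalf cos_pihalf mul0r subr0 mul1r cosB sal cal /p.
  transitivity ((psi * cos th + d * (cos th ^+ 2 + sin th ^+ 2)) / s).
    by field; rewrite gt_eqF.
  by rewrite cs1 mulr1.
have cE : cos (pi / 2 - (th - al)) = q / s.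
  by rewrite cosB cos_pihalf sin_pihalf mul0r add0r mul1r.
have pE : sin (pi / 2 - th) = p / psi.
  rewrite sinB sin_pihalf cos_pihalf mul0r subr0 mul1r.
  by rewrite /p mulrAC divff ?mul1r// gt_eqF.
have cpE : cos (pi / 2 - th) = sin th.
  by rewrite cosB cos_pihalf sin_pihalf mul0r add0r mul1r.
have K0 : semicircle_primitive (0 : R) = 0.
  rewrite -sin0 semicircle_primitive_sin ?sin0 ?mul0r ?add0r ?mul0r//.
  by apply/andP; split; lra.
rewrite -bE -sga -pE K0 !semicircle_primitive_sin//; last 2 first.
- by apply/andP; split; lra.
- by apply/andP; split; lra.
rewrite bE cE pE cpE sga cga /V -/r -/ga tE -/al.
rewrite (_ : 2 * th = th *+ 2) ?sin_mulr2n; last by rewrite mulr_natl.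
clearbody s r al ga; rewrite /p /q; field.
by rewrite !gt_eqF.
Qed.
End PolarForm.

(** * Void probabilities and independence of Poisson counts *)

Section MeasureFacts.
Context {R : realType} {d : measure_display} {T : measurableType d}.

Lemma measurable_set_ltr (f g : T -> R) :
  measurable_fun setT f -> measurable_fun setT g ->
  measurable [set x | f x < g x].
Proof.
move=> mf mg.
rewrite [X in measurable X](_ : _ = (fun x => f x < g x) @^-1` [set true])//.
by apply: measurable_preimageT (measurable_fun_ltr mf mg) _.
Qed.

Lemma measurable_set_ler (f g : T -> R) :
  measurable_fun setT f -> measurable_fun setT g ->
  measurable [set x | f x <= g x].
Proof.
move=> mf mg.
rewrite [X in measurable X](_ : _ = (fun x => f x <= g x) @^-1` [set true])//.
by apply: measurable_preimageT (measurable_fun_ler mf mg) _.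
Qed.

Lemma measurable_set_eqr (f g : T -> R) :
  measurable_fun setT f -> measurable_fun setT g ->
  measurable [set x | f x = g x].
Proof.
move=> mf mg.
rewrite [X in measurable X](_ : _ = (fun x => f x == g x) @^-1` [set true]).
  by apply: measurable_preimageT (measurable_fun_eqr mf mg) _.
by apply/funext => x; apply/propext; split => /eqP.
Qed.

(** The minimizers are such only almost surely, so inclusions between the events they define hold up
    to a null set. *)
Lemma ae_le_measure (mu : {measure set T -> \bar R}) (A B : set T) :
  measurable A -> measurable B -> {ae mu, forall x, A x -> B x} ->
  (mu A <= mu B)%E.
Proof.
move=> mA mB [N [mN N0 AN]].
rewrite (@le_trans _ _ (mu (B `|` N)))//.
  apply: le_measure; [exact/mem_set|by apply/mem_set; exact: measurableU|].
  move=> x Ax; have [Bx|Bx] := pselect (B x); first by left.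
  by right; apply: AN => /= /(_ Ax).
by apply: (le_trans (measureU2 _ _ _)) => //; rewrite [X in (_ + X)%E]N0 adde0.
Qed.

Lemma measure_setU_null (mu : {measure set T -> \bar R})
    (A B N : set T) : measurable A -> measurable B -> measurable N ->
  mu N = 0%E -> A `<=` B -> B `<=` A `|` N -> mu A = mu B.
Proof.
move=> mA mB mN N0 AB BAN; apply/eqP; rewrite eq_le le_measure ?inE//=.
apply: le_trans (_ : mu (A `|` N) <= _)%E.
  by apply: le_measure => //; [exact/mem_set|apply/mem_set; exact: measurableU].
by apply: (le_trans (measureU2 _ _ _)) => //; rewrite [X in (_ + X)%E]N0 adde0.
Qed.

End MeasureFacts.

(** * Real-valued areas of bounded sets *)

Section Area.
Context {R : realType}.
Implicit Types A B C : set (R * R).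

Definition rarea A : R := fine (area A).

Lemma rareaK A : bounded_set A -> measurable A -> (rarea A)%:E = area A.
Proof.
by move=> bA mA; rewrite fineK// ge0_fin_numE ?measure_ge0// area_bounded_lty.
Qed.

Lemma rarea_ge0 A : 0 <= rarea A.
Proof. exact: fine_ge0. Qed.

Lemma le_rarea A B : measurable A -> measurable B -> bounded_set B -> A `<=` B ->
  rarea A <= rarea B.
Proof.
move=> mA mB bB AB; rewrite -lee_fin !rareaK//; last exact: bounded_setW bB.
by apply: le_measure => //; exact/mem_set.
Qed.

Lemma bounded_setU A B : bounded_set A -> bounded_set B -> bounded_set (A `|` B).
Proof.
move=> [M [Mr AM]] [M' [M'r BM']]; exists (Num.max M M'); split; first exact: num_real.
by move=> x; rewrite gt_max => /andP[/AM Ax /BM' Bx] y [/Ax|/Bx].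
Qed.

Lemma le_rareaU A B C : measurable A -> measurable B -> measurable C ->
  bounded_set B -> bounded_set C -> A `<=` B `|` C ->
  rarea A <= rarea B + rarea C.
Proof.
move=> mA mB mC bB bC ABC; have mBC : measurable (B `|` C) by exact: measurableU.
have bBC := bounded_setU bB bC.
rewrite (le_trans (le_rarea mA mBC bBC ABC))//.
by rewrite -lee_fin EFinD !rareaK//; exact: measureU2.
Qed.
End Area.

(** * Counts of a Poisson process in disjoint regions *)

Section PPP.
Context {R : realType} {d : measure_display} {Omega : measurableType d}.
Variables (P : probability Omega R) (lambda : R) (Phi : Omega -> set (R * R)).
Hypotheses (lambda_gt0 : 0 < lambda) (PPP : homogeneous_PPP P lambda Phi).
Implicit Types B : set (R * R).
Local Notation N := (npoints Phi).

Lemma npoints_eq0 B omega : bounded_set B ->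
  N B omega = 0%N <-> Phi omega `&` B = set0.
Proof.
case: PPP => fin _ _ _ bB; have finB := fin omega B bB.
rewrite /npoints; split => [/cardfs0_eq|->]; last by rewrite fset_set0.
by move/(congr1 (fun X : {fset _} => [set` X])); rewrite fset_setK// set_fset0.
Qed.

Lemma npoints_eq1 B omega : bounded_set B ->
  N B omega = 1%N -> exists x, Phi omega `&` B = [set x].
Proof.
case: PPP => fin _ _ _ bB; have finB := fin omega B bB.
move=> /eqP/cardfs1P[x xE]; exists x.
by rewrite -(fset_setK finB) xE set_fset1.
Qed.

Lemma measurable_npoints B (K : set nat) : bounded_set B -> measurable B ->
  measurable (N B @^-1` K).
Proof.
case: PPP => _ mN _ _ bB mB.
by apply: measurable_preimageT (mN B bB mB) _.
Qed.

(** At rate 0, reached for regions of area 0, [poisson_prob] is a Dirac mass by convention; the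
    formula agrees since [0 ^+ 0 = 1]. *)
Lemma poisson_prob1 (x : R) (n : nat) : 0 <= x ->
  poisson_prob x 0 [set n] = (x ^+ n * n`!%:R^-1 * expR (- x))%:E.
Proof.
rewrite le_eqVlt /poisson_prob => /predU1P[<-|x0].
  rewrite ltxx oppr0 expR0 mulr1 diracE; case: n => [|n].
    by rewrite mem_set// expr0 mul1r fact0 invr1.
  by rewrite memNset// expr0n/= mul0r.
rewrite x0 esum_set1; first by rewrite /poisson_pmf x0.
by rewrite lee_fin poisson_pmf_ge0.
Qed.

Lemma prob_npoints_eq B (n : nat) : bounded_set B -> measurable B ->
  P (N B @^-1` [set n]) =
  ((lambda * rarea B) ^+ n * n`!%:R^-1 * expR (- (lambda * rarea B)))%:E.
Proof.
case: PPP => _ _ pN _ bB mB.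
by rewrite pN// poisson_prob1// mulr_ge0 ?rarea_ge0// ltW.
Qed.

Lemma prob_npoints_eq0 B : bounded_set B -> measurable B ->
  P (N B @^-1` [set 0%N]) = (expR (- (lambda * rarea B)))%:E.
Proof. by move=> bB mB; rewrite prob_npoints_eq// expr0 fact0 invr1 !mul1r. Qed.

Lemma prob_npoints_eq1 B : bounded_set B -> measurable B ->
  P (N B @^-1` [set 1%N]) = (lambda * rarea B * expR (- (lambda * rarea B)))%:E.
Proof. by move=> bB mB; rewrite prob_npoints_eq// expr1 invr1 mulr1. Qed.

Lemma prob_npoints_gt0 B : bounded_set B -> measurable B ->
  P (N B @^-1` [set n | (0 < n)%N]) = (1 - expR (- (lambda * rarea B)))%:E.
Proof.
move=> bB mB; rewrite EFinB -prob_npoints_eq0// -probability_setC; last first.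
  exact: measurable_npoints.
by congr (P _); apply/seteqP; split => w /=; rewrite lt0n => /eqP.
Qed.

(** Four regions are what [prob_coincide_cell_ge] needs: the inner disc, the part of the cell, the
    rest of the annulus, and the region to be void beyond it. *)
Lemma prob_npoints_indep4 (B0 B1 B2 B3 : set (R * R)) (K0 K1 K2 K3 : set nat) :
  bounded_set B0 -> bounded_set B1 -> bounded_set B2 -> bounded_set B3 ->
  measurable B0 -> measurable B1 -> measurable B2 -> measurable B3 ->
  B0 `&` B1 = set0 -> B0 `&` B2 = set0 -> B0 `&` B3 = set0 ->
  B1 `&` B2 = set0 -> B1 `&` B3 = set0 -> B2 `&` B3 = set0 ->
  (P (N B0 @^-1` K0 `&` N B1 @^-1` K1 `&` N B2 @^-1` K2 `&` N B3 @^-1` K3) =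
   P (N B0 @^-1` K0) * P (N B1 @^-1` K1) * P (N B2 @^-1` K2) * P (N B3 @^-1` K3))%E.
Proof.
move=> b0 b1 b2 b3 m0 m1 m2 m3 d01 d02 d03 d12 d13 d23.
pose B (i : 'I_4) := nth set0 [:: B0; B1; B2; B3] i.
pose K (i : 'I_4) := nth set0 [:: K0; K1; K2; K3] i.
case: PPP => _ _ _ /(_ 4%N B K) indep.
have : P (\bigcap_(i in [set: 'I_4]) (N (B i) @^-1` K i)) =
    (\prod_(i < 4) P (N (B i) @^-1` K i))%E.
  apply: indep; [by move=> [[|[|[|[|//]]]] i4]..|].
  move=> [[|[|[|[|//]]]] i4] [[|[|[|[|//]]]] j4] _ _ /=;
    rewrite /B/= ?(d01, d02, d03, d12, d13, d23, setIC B1 B0, setIC B2 B0,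
      setIC B3 B0, setIC B2 B1, setIC B3 B1, setIC B3 B2, d01, d02, d03, d12,
      d13, d23) ?setIid;
    by [move=> _; exact: val_inj|case].
rewrite !big_ord_recl big_ord0 mule1 /= !muleA => <-; congr (P _).
apply/seteqP; split => [w [[[w0 w1] w2] w3] [[|[|[|[|//]]]] i4] _ //|w h].
split; first split; first split.
- exact: (h (@Ordinal 4 0 isT)).
- exact: (h (@Ordinal 4 1 isT)).
- exact: (h (@Ordinal 4 2 isT)).
- exact: (h (@Ordinal 4 3 isT)).
Qed.

(** Pads the family with the empty region and the sure constraint [setT]. *)
Lemma prob_npoints_indep3 (B0 B1 B2 : set (R * R)) (K0 K1 K2 : set nat) :
  bounded_set B0 -> bounded_set B1 -> bounded_set B2 ->
  measurable B0 -> measurable B1 -> measurable B2 ->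
  B0 `&` B1 = set0 -> B0 `&` B2 = set0 -> B1 `&` B2 = set0 ->
  (P (N B0 @^-1` K0 `&` N B1 @^-1` K1 `&` N B2 @^-1` K2) =
   P (N B0 @^-1` K0) * P (N B1 @^-1` K1) * P (N B2 @^-1` K2))%E.
Proof.
move=> b0 b1 b2 m0 m1 m2 d01 d02 d12.
have bnd0 : bounded_set (@set0 (R * R)) by exact: bounded_setW b0.
have := @prob_npoints_indep4 B0 B1 B2 set0 K0 K1 K2 setT
  b0 b1 b2 bnd0 m0 m1 m2 measurable0 d01 d02.
rewrite !setI0 !preimage_setT setIT probability_setT mule1.
by apply.
Qed.

Lemma prob_npoints_indep2 (B0 B1 : set (R * R)) (K0 K1 : set nat) :
  bounded_set B0 -> bounded_set B1 -> measurable B0 -> measurable B1 ->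
  B0 `&` B1 = set0 ->
  (P (N B0 @^-1` K0 `&` N B1 @^-1` K1) =
   P (N B0 @^-1` K0) * P (N B1 @^-1` K1))%E.
Proof.
move=> b0 b1 m0 m1 d01.
have bnd0 : bounded_set (@set0 (R * R)) by exact: bounded_setW b0.
have := @prob_npoints_indep3 B0 B1 set0 K0 K1 setT
  b0 b1 bnd0 m0 m1 measurable0 d01.
rewrite !setI0 !preimage_setT setIT probability_setT mule1.
by apply.
Qed.

End PPP.

(** * Coincidence of two minimizers over a Poisson process *)

Section CoincidingMinimizers.
Context {R : realType} {d : measure_display} {Omega : measurableType d}.
Variables (P : probability Omega R) (lambda : R) (Phi : Omega -> set (R * R)).
Hypotheses (lambda_gt0 : 0 < lambda) (PPP : homogeneous_PPP P lambda Phi).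
Variables (r s : R * R -> R) (X Y : Omega -> R * R).
Hypotheses (mr : measurable_fun setT r) (ms : measurable_fun setT s).
Hypotheses (bounded_r : forall a, bounded_set [set x | r x < a])
           (bounded_s : forall a, bounded_set [set x | s x < a]).
Hypotheses (mX : measurable_fun setT X) (mY : measurable_fun setT Y).
Hypotheses (XE : {ae P, forall omega, is_argmin r (Phi omega) (X omega)})
           (YE : {ae P, forall omega, is_argmin s (Phi omega) (Y omega)}).

Local Notation N := (npoints Phi).

(* The region that has to be free of points when [x] minimizes [r]
   and is to minimize [s] as well. *)
Definition voided (x : R * R) : set (R * R) := [set y | s y < s x /\ r x <= r y].

Definition void_prob (x : R * R) : R := expR (- (lambda * rarea (voided x))).

Lemma void_prob_ge0 x : 0 <= void_prob x. Proof. exact: expR_ge0. Qed.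

(** [voided x] is the section at [x] of a measurable subset of the product, so no formula for its
    area is involved. *)
Lemma measurable_void_prob : measurable_fun setT void_prob.
Proof.
apply: measurableT_comp => //; apply: measurable_funN; apply: measurable_funM => //.
apply: measurableT_comp; first exact: fine_measurable.
pose W := [set z : (R * R) * (R * R) | s z.2 < s z.1 /\ r z.1 <= r z.2].
have mW : measurable W.
  apply: measurableI.
    by apply: measurable_set_ltr; exact: measurableT_comp.
  by apply: measurable_set_ler; exact: measurableT_comp.
have := @measurable_fun_xsection _ _ _ _ R area _ mW.
apply: eq_measurable_fun => x _ /=; congr area.
by apply/seteqP; split => y /=; rewrite /xsection/= inE.
Qed.

Lemma measurable_coincide : measurable [set w | X w = Y w].
Proof.
rewrite (_ : [set _ | _] = [set w | (X w).1 = (Y w).1] `&` [set w | (X w).2 = (Y w).2]).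
  by apply: measurableI; apply: measurable_set_eqr; exact: measurableT_comp.
apply/seteqP; split => w /=; first by move=> ->.
by move=> [h1 h2]; exact: injective_projections.
Qed.

Let ball a := [set x : R * R | r x < a].
Let ann a b := ball b `\` ball a.
Let lev u := [set x : R * R | s x < u].
Let slab u v := lev v `\` lev u.

Let mball a : measurable (ball a).
Proof. exact: measurable_set_ltr. Qed.
Let mlev a : measurable (lev a).
Proof. exact: measurable_set_ltr. Qed.
Let mann a b : measurable (ann a b).
Proof. exact: measurableD. Qed.
Let mslab a b : measurable (slab a b).
Proof. exact: measurableD. Qed.
Let bball a : bounded_set (ball a). Proof. exact: bounded_r. Qed.
Let bann a b : bounded_set (ann a b).
Proof. by apply: bounded_setW (bounded_r b) => x []. Qed.
Let bslab a b : bounded_set (slab a b).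
Proof. by apply: bounded_setW (bounded_s b) => x []. Qed.

(** To be rewritten from right to left: a product of reals becomes the probability of an
    intersection of independent events. *)
Let mulEFin2 (p p0 p1 : \bar R) (x y : R) : p = (p0 * p1)%E ->
  p0 = x%:E -> p1 = y%:E -> p = (x * y)%:E.
Proof. by move=> -> -> ->. Qed.
Let mulEFin3 (p p0 p1 p2 : \bar R) (x y z : R) : p = (p0 * p1 * p2)%E ->
  p0 = x%:E -> p1 = y%:E -> p2 = z%:E -> p = (x * y * z)%:E.
Proof. by move=> -> -> -> ->. Qed.
Let mulEFin4 (p p0 p1 p2 p3 : \bar R) (x y z t : R) : p = (p0 * p1 * p2 * p3)%E ->
  p0 = x%:E -> p1 = y%:E -> p2 = z%:E -> p3 = t%:E -> p = (x * y * z * t)%:E.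
Proof. by move=> -> -> -> -> ->. Qed.

Let ler_lambda (x y : R) : x <= y -> lambda * x <= lambda * y.
Proof. by rewrite ler_pM2l. Qed.
Let ler_expRN (x y : R) : x <= y -> expR (- (lambda * y)) <= expR (- (lambda * x)).
Proof. by move=> xy; rewrite ler_expR lerN2 ler_lambda. Qed.

(** * Bounds on the probabilities attached to a part of one cell *)

Section Cell.
Variables (a b u v : R).
Hypotheses (ab : a <= b).
Variable C : set (R * R).
Hypotheses (mC : measurable C) (Cann : C `<=` ann a b) (Cslab : C `<=` slab u v).

Let bC : bounded_set C. Proof. exact: bounded_setW Cann (bann a b). Qed.
Let mlevball w : measurable (lev w `\` ball b). Proof. exact: measurableD. Qed.
Let blevball w : bounded_set (lev w `\` ball b).
Proof. by apply: bounded_setW (bounded_s w) => x []. Qed.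
Let mannC : measurable (ann a b `\` C). Proof. exact: measurableD. Qed.
Let bannC : bounded_set (ann a b `\` C).
Proof. by apply: bounded_setW (bann a b) => x []. Qed.
Let mXC : measurable (X @^-1` C). Proof. exact: measurable_preimageT mX mC. Qed.

Let ball_C : ball a `&` C = set0.
Proof. by rewrite -subset0 => x [xa /Cann[]]. Qed.
Let ball_lev w : ball a `&` (lev w `\` ball b) = set0.
Proof. by rewrite -subset0 => x [xa [_ xb]]; apply: xb; exact: lt_le_trans ab. Qed.
Let ball_annC : ball a `&` (ann a b `\` C) = set0.
Proof. by rewrite -subset0 => x [xa [[]]]. Qed.
Let C_lev w : C `&` (lev w `\` ball b) = set0.
Proof. by rewrite -subset0 => x [/Cann[xb _] []]. Qed.
Let C_annC : C `&` (ann a b `\` C) = set0.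
Proof. by rewrite -subset0 => x [? []]. Qed.
Let annC_lev w : (ann a b `\` C) `&` (lev w `\` ball b) = set0.
Proof. by rewrite -subset0 => x [[[? ?] ?] []]. Qed.

Let argmin_void w : is_argmin r (Phi w) (X w) -> C (X w) -> N (ball a) w = 0%N.
Proof.
move=> [Xw Xmin] /Cann[_ aX]; apply/(npoints_eq0 PPP _ (bounded_r a)).
rewrite -subset0 => x [/Xmin Xx xa]; apply: aX; exact: le_lt_trans xa.
Qed.

Let argmin_pos w : is_argmin r (Phi w) (X w) -> C (X w) -> (0 < N C w)%N.
Proof.
move=> [Xw Xmin] CX; rewrite lt0n; apply/eqP => /(npoints_eq0 PPP _ bC) NC0.
by have : (Phi w `&` C) (X w) by []; rewrite NC0.
Qed.

(** A minimizer in [C] leaves [ball a] empty and [C] occupied, and these two regions are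
    disjoint. *)
Lemma prob_cell_le : (P (X @^-1` C) <=
  (expR (- (lambda * rarea (ball a))) * (1 - expR (- (lambda * rarea C))))%:E)%E.
Proof.
rewrite -(mulEFin2
  (prob_npoints_indep2 PPP _ _ (bball a) bC (mball a) mC ball_C)
  (prob_npoints_eq0 lambda_gt0 PPP (bball a) (mball a))
  (prob_npoints_gt0 lambda_gt0 PPP bC mC)).
apply: ae_le_measure => //.
  by apply: measurableI; apply: (measurable_npoints PPP).
apply: filterS XE => w Xw CX; split; [exact: argmin_void|exact: argmin_pos].
Qed.

Let argmin_mem w : is_argmin r (Phi w) (X w) -> N (ball a) w = 0%N ->
  (0 < N C w)%N -> N (ann a b `\` C) w = 0%N -> C (X w).
Proof.
move=> [PX Xmin] /(npoints_eq0 PPP _ (bounded_r a)) N0 NC /(npoints_eq0 PPP _ bannC) NA.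
have [x [Px Cx]] : Phi w `&` C !=set0.
  by apply/set0P/eqP => /(npoints_eq0 PPP _ bC) NC0; rewrite NC0 in NC.
apply: contrapT => nC.
have : (Phi w `&` (ann a b `\` C)) (X w).
  split => //; split => //; split.
    by have [xb _] := Cann Cx; exact: le_lt_trans (Xmin _ Px) xb.
  by move=> Xa; have : (Phi w `&` ball a) (X w) by []; rewrite N0.
by rewrite NA.
Qed.

(** If [ball a] and the rest of the annulus are empty while [C] is not, the minimizer is in [C].
    Replacing the rest by the whole annulus leaves a bound where [C] occurs through its area
    only. *)
Lemma prob_cell_ge :
  ((expR (- (lambda * rarea (ball a))) * (1 - expR (- (lambda * rarea C)))
    * expR (- (lambda * rarea (ann a b))))%:E <= P (X @^-1` C))%E.
Proof.
apply: (@le_trans _ _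
    (expR (- (lambda * rarea (ball a))) * (1 - expR (- (lambda * rarea C)))
    * expR (- (lambda * rarea (ann a b `\` C))))%:E).
  rewrite lee_fin; apply: ler_wpM2l.
    apply: mulr_ge0; first exact: expR_ge0.
    rewrite subr_ge0 -[leRHS]expR0 ler_expR oppr_le0.
    by apply: mulr_ge0; [exact: ltW|exact: rarea_ge0].
  rewrite ler_expR lerN2 ler_pM2l//; apply: le_rarea => //; exact: subDsetl.
rewrite -(mulEFin3
  (prob_npoints_indep3 PPP _ _ _ (bball a) bC bannC (mball a) mC mannC
    ball_C ball_annC C_annC)
  (prob_npoints_eq0 lambda_gt0 PPP (bball a) (mball a))
  (prob_npoints_gt0 lambda_gt0 PPP bC mC)
  (prob_npoints_eq0 lambda_gt0 PPP bannC mannC)).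
apply: ae_le_measure => //.
  by apply: measurableI; [apply: measurableI|]; apply: (measurable_npoints PPP).
by apply: filterS XE => w Xw [[? ?] ?]; exact: argmin_mem.
Qed.

(** If [X = Y] lies in [C], no point of [Phi] is in [lev u]. Only the part outside of [ball b] is
    retained, as it is disjoint from [ball a] and [C]. *)
Lemma prob_coincide_cell_le : (P ([set w | X w = Y w] `&` X @^-1` C) <=
  (expR (- (lambda * rarea (ball a))) * (1 - expR (- (lambda * rarea C)))
   * expR (- (lambda * rarea (lev u `\` ball b))))%:E)%E.
Proof.
rewrite -(mulEFin3
  (prob_npoints_indep3 PPP _ _ _ (bball a) bC (blevball u) (mball a) mC (mlevball u)
    ball_C (ball_lev u) (C_lev u))
  (prob_npoints_eq0 lambda_gt0 PPP (bball a) (mball a))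
  (prob_npoints_gt0 lambda_gt0 PPP bC mC)
  (prob_npoints_eq0 lambda_gt0 PPP (blevball u) (mlevball u))).
apply: ae_le_measure => //.
- by apply: measurableI => //; exact: measurable_coincide.
- by apply: measurableI; [apply: measurableI|]; apply: (measurable_npoints PPP).
apply: filterS2 XE YE => w Xw [Yw Ymin] [XY CX].
split; first split; [exact: argmin_void|exact: argmin_pos|].
apply/(npoints_eq0 PPP _ (blevball u)); rewrite -subset0 => x [/Ymin Yx [xu _]].
have [_] := Cslab CX; apply; rewrite /lev /= in XY *; rewrite XY.
exact: le_lt_trans Yx xu.
Qed.

(* The unique point of [Phi] in [C] is the only one in [{r < b}] and in [{s < v}],
   hence minimizes both [r] and [s]. *)
Lemma prob_coincide_cell_ge :
  ((expR (- (lambda * rarea (ball a)))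
   * (lambda * rarea C * expR (- (lambda * rarea C)))
   * expR (- (lambda * rarea (ann a b)))
   * expR (- (lambda * rarea (lev v `\` ball b))))%:E
   <= P ([set w | X w = Y w] `&` X @^-1` C))%E.
Proof.
apply: (@le_trans _ _ (expR (- (lambda * rarea (ball a)))
   * (lambda * rarea C * expR (- (lambda * rarea C)))
   * expR (- (lambda * rarea (ann a b `\` C)))
   * expR (- (lambda * rarea (lev v `\` ball b))))%:E).
  rewrite lee_fin; apply: ler_wpM2r; first exact: expR_ge0.
  apply: ler_wpM2l.
    apply: mulr_ge0; first exact: expR_ge0.
    apply: mulr_ge0; last exact: expR_ge0.
    by apply: mulr_ge0; [exact: ltW|exact: rarea_ge0].
  rewrite ler_expR lerN2 ler_pM2l//; apply: le_rarea => //; exact: subDsetl.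
rewrite -(mulEFin4
  (prob_npoints_indep4 PPP _ _ _ _ (bball a) bC bannC (blevball v) (mball a) mC mannC
    (mlevball v) ball_C ball_annC (ball_lev v) C_annC (C_lev v) (annC_lev v))
  (prob_npoints_eq0 lambda_gt0 PPP (bball a) (mball a))
  (prob_npoints_eq1 lambda_gt0 PPP bC mC)
  (prob_npoints_eq0 lambda_gt0 PPP bannC mannC)
  (prob_npoints_eq0 lambda_gt0 PPP (blevball v) (mlevball v))).
apply: ae_le_measure => //.
- by apply: measurableI; [apply: measurableI; [apply: measurableI|]|];
    apply: (measurable_npoints PPP).
- by apply: measurableI => //; exact: measurable_coincide.
apply: filterS2 XE YE => w Xw [PY Ymin] [[[N0 N1] NA] NL].
have CX : C (X w) by apply: argmin_mem => //; rewrite [N C w]N1.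
split => //=; have [c cE] := npoints_eq1 PPP bC N1.
have [Px Cx] : (Phi w `&` C) (X w) by case: Xw.
have Ylev : lev v (Y w).
  by have [xv _] := Cslab CX; exact: le_lt_trans (Ymin _ Px) xv.
have Yb : ball b (Y w).
  apply: contrapT => nYb; move/(npoints_eq0 PPP _ (blevball v)) : NL => NL.
  by have : (Phi w `&` (lev v `\` ball b)) (Y w) by []; rewrite NL.
have CY : C (Y w).
  apply: contrapT => nCY.
  have [Ya|nYa] := pselect (ball a (Y w)).
    move/(npoints_eq0 PPP _ (bounded_r a)) : N0 => N0.
    by have : (Phi w `&` ball a) (Y w) by []; rewrite [ball a]/ball N0.
  move/(npoints_eq0 PPP _ bannC) : NA => NA.
  by have : (Phi w `&` (ann a b `\` C)) (Y w) by []; rewrite NA.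
have : (Phi w `&` C) (X w) by [].
have : (Phi w `&` C) (Y w) by [].
by rewrite cE => -> ->.
Qed.

Lemma integral_void_cell (m M : R) : (forall x, C x -> m <= void_prob x <= M) ->
  0 <= m ->
  (m%:E * P (X @^-1` C) <= \int[P]_(w in X @^-1` C) (void_prob (X w))%:E
     <= M%:E * P (X @^-1` C))%E.
Proof.
move=> mM m0.
have mg : measurable_fun (X @^-1` C) (fun w => (void_prob (X w))%:E).
  apply/measurable_EFinP; apply: measurable_funTS.
  exact: measurableT_comp measurable_void_prob mX.
rewrite -!integral_cst//; apply/andP; split; apply: ge0_le_integral => //.
- by move=> w /mM/andP[mg' _]; rewrite lee_fin.
- by move=> w _; rewrite lee_fin void_prob_ge0.
- by move=> w /mM/andP[_ gM]; rewrite lee_fin.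
Qed.

Let voided_ge x : C x -> lev u `\` ball b `<=` voided x.
Proof.
move=> Cx y [yu yb]; have [xb _] := Cann Cx; have [_ ux] := Cslab Cx.
rewrite /ball/= in xb yb; rewrite /lev/= in yu ux; split.
  by apply: lt_le_trans yu _; rewrite leNgt; apply/negP.
by rewrite (le_trans (ltW xb))// leNgt; apply/negP.
Qed.

Let voided_le x : C x -> voided x `<=` (lev u `\` ball b) `|` (ann a b `|` slab u v).
Proof.
move=> Cx y [yx xy]; have [_ ax] := Cann Cx; have [xv _] := Cslab Cx.
have [yu|yu] := pselect (lev u y); last first.
  by right; right; split => //; exact: lt_trans yx xv.
have [yb|yb] := pselect (ball b y); last by left.
by right; left; split => //; move=> ya; apply: ax; exact: le_lt_trans xy ya.
Qed.

Let bvoided x : bounded_set (voided x).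
Proof. by apply: bounded_setW (bounded_s (s x)) => y []. Qed.

Let mvoided x : measurable (voided x).
Proof.
by apply: measurableI; [exact: measurable_set_ltr|exact: measurable_set_ler].
Qed.

(** A point of [voided x] in [lev u] but in [ball b] has [r] between the bounds of the cell; one
    outside of [lev u] has [s] between its bounds. Hence an annulus and a slab bound the error. *)
Lemma rarea_voided_cell x : C x ->
  rarea (lev u `\` ball b) <= rarea (voided x) <=
  rarea (lev u `\` ball b) + (rarea (ann a b) + rarea (slab u v)).
Proof.
move=> Cx.
have mU : measurable (ann a b `|` slab u v) by exact: measurableU.
have bU : bounded_set (ann a b `|` slab u v) by exact: bounded_setU.
apply/andP; split.
  exact: (le_rarea (mlevball u) (mvoided x) (bvoided x) (voided_ge Cx)).
apply: le_trans
  (le_rareaU (mvoided x) (mlevball u) mU (blevball u) bU (voided_le Cx)) _.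
rewrite lerD2l.
exact: (le_rareaU mU (mann a b) (mslab u v) (bann a b) (bslab u v)
  (@subset_refl _ _)).
Qed.

End Cell.

(** * Comparison of two parts of a cell with equal areas *)

Section CellCompare.
Variables (a b u v k : R) (C C' : set (R * R)).
Hypotheses (ab : a <= b) (mC : measurable C) (mC' : measurable C').
Hypotheses (Cann : C `<=` ann a b) (Cslab : C `<=` slab u v).
Hypotheses (C'ann : C' `<=` ann a b) (C'slab : C' `<=` slab u v).
Hypothesis CC' : rarea C = rarea C'.
Hypotheses (annk : rarea (ann a b) <= k) (slabk : rarea (slab u v) <= k).

Let al := rarea (lev u `\` ball b).
Let be := rarea (ball a).
Let c := rarea C.

Let void_bounds x : C' x ->
  expR (- (lambda * (al + (k + k)))) <= void_prob x <= expR (- (lambda * al)).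
Proof.
move=> C'x; have /andP[h1 h2] := rarea_voided_cell C'ann C'slab C'x.
apply/andP; split; apply: ler_expRN; last exact: h1.
apply: le_trans h2 _; apply: lerD; first exact: lexx.
by apply: lerD; [exact: annk|exact: slabk].
Qed.

Let pos_ge0 : 0 <= 1 - expR (- (lambda * c)).
Proof.
by rewrite subr_ge0 -[leRHS]expR0 ler_expR oppr_le0 mulr_ge0 ?rarea_ge0// ltW.
Qed.

Let bC' : bounded_set C'. Proof. exact: bounded_setW C'ann (bann a b). Qed.

(** The constant 3 counts the losses in the lower bound of the integral: [k] for the annulus that
    [prob_cell_ge] wants empty, and [k + k] in the area of [voided]. *)
Lemma prob_le_integral_cell :
  (P ([set w | X w = Y w] `&` X @^-1` C) <=
   (expR (3 * lambda * k))%:E * \int[P]_(w in X @^-1` C') (void_prob (X w))%:E)%E.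
Proof.
apply: (le_trans (prob_coincide_cell_le ab mC Cann Cslab)).
rewrite -/al -/be -/c.
have /andP[le1 _] := integral_void_cell mC' void_bounds (expR_ge0 _).
have le2 := prob_cell_ge mC' C'ann.
have e0 (x : R) : (0 <= (expR x)%:E)%E by rewrite lee_fin expR_ge0.
apply: (le_trans _ (lee_wpmul2l (e0 _) (le_trans (lee_wpmul2l (e0 _) le2) le1))).
rewrite -[leRHS]/((_ * (_ * _))%R%:E) lee_fin -CC' -/be -/c.
have alg (A x E1 E2 E3 : R) :
    0 <= A -> x <= E1 * E2 * E3 -> A * x <= E1 * (E2 * (A * E3)).
  move=> A0 xE; apply: le_trans (ler_wpM2l A0 xE) _.
  by rewrite le_eqVlt; apply/orP; left; apply/eqP; ring.
apply: alg; first by apply: mulr_ge0 => //; exact: expR_ge0.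
rewrite -2!expRD ler_expR.
have lin (x y : R) : x <= lambda * k ->
    - (lambda * y) <= 3 * lambda * k - lambda * (y + (k + k)) - x by lra.
exact: lin (ler_lambda annk).
Qed.

(** The three [k] now bound the area of [C], the annulus and the slab. The inequality 1 - exp(- y)
    <= y passes from at least one point in the cell part to exactly one. *)
Lemma integral_le_prob_cell :
  (\int[P]_(w in X @^-1` C') (void_prob (X w))%:E <=
   (expR (3 * lambda * k))%:E * P ([set w | X w = Y w] `&` X @^-1` C))%E.
Proof.
have /andP[_ le1] := integral_void_cell mC' void_bounds (expR_ge0 _).
apply: (le_trans le1).
have e0 (x : R) : (0 <= (expR x)%:E)%E by rewrite lee_fin expR_ge0.
apply: (le_trans (lee_wpmul2l (e0 _) (prob_cell_le mC' C'ann))).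
apply: (le_trans _ (lee_wpmul2l (e0 _) (prob_coincide_cell_ge ab mC Cann Cslab))).
rewrite -[leRHS]/((_ * _)%R%:E) -[leLHS]/((_ * _)%R%:E) lee_fin -CC' -/be -/c.
have alg (A p q x E1 E2 E3 E4 : R) : 0 <= A -> 0 <= p -> p <= q -> 0 <= x ->
    x <= E1 * E2 * E3 * E4 -> x * (A * p) <= E1 * (A * (q * E2) * E3 * E4).
  move=> A0 p0 pq x0 xE.
  rewrite (_ : x * (A * p) = A * (p * x)); last by ring.
  rewrite (_ : E1 * _ = A * (q * (E1 * E2 * E3 * E4))); last by ring.
  by apply: ler_wpM2l => //; exact: ler_pM.
apply: alg; [exact: expR_ge0|exact: pos_ge0| |exact: expR_ge0|].
  by rewrite lerBlDr -lerBlDl; exact: expR_ge1Dx.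
rewrite -3!expRD ler_expR.
have ck : c <= k.
  apply: le_trans annk.
  by apply: le_rarea; [exact: mC|exact: mann|exact: bann|exact: Cann].
have levk : rarea (lev v `\` ball b) <= al + k.
  apply: le_trans (lerD (lexx _) slabk).
  apply: le_rareaU; [exact: measurableD|exact: measurableD|exact: mslab| |
    exact: bslab|].
    by apply: bounded_setW (bounded_s u) => x [].
  by move=> y [yv yb]; have [yu|yu] := pselect (lev u y); [left|right].
have lin (x1 x2 x3 x4 : R) : x1 <= lambda * k -> x2 <= lambda * k ->
    x3 <= lambda * (x4 + k) -> - (lambda * x4) <= 3 * lambda * k - x2 - x1 - x3 by lra.
exact: lin (ler_lambda annk) (ler_lambda ck) (ler_lambda levk).
Qed.

End CellCompare.
Hypotheses (r_ge0 : forall x, 0 <= r x) (s_ge0 : forall x, 0 <= s x).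
Variable kappa : R.
Hypothesis kappa_gt0 : 0 < kappa.
Hypothesis annle : forall a t, 0 <= a -> 0 <= t -> rarea (ann a (a + t)) <= kappa * t.
Hypothesis slable : forall a t, 0 <= a -> 0 <= t -> rarea (slab a (a + t)) <= kappa * t.
Variables Q Q' : set (R * R).
Hypotheses (mQ : measurable Q) (mQ' : measurable Q').
Hypothesis QQ' : forall a b u v,
  rarea (Q `&` (ann a b `&` slab u v)) = rarea (Q' `&` (ann a b `&` slab u v)).

(** * Summation over a grid of mesh [t] *)

Section Grid.
Variable t : R.
Hypothesis t_gt0 : 0 < t.

(** Pairs of indices are coded by a single number to get plain series; a number coding no pair has
    an empty cell, whence the first case of [cellP]. *)
Let idx (x : R * R) : nat := pickle (Num.truncn (r x / t), Num.truncn (s x / t)).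
Let cell n := [set x | idx x = n].

(** The negation matches the set differences that define [ann] and [slab]. *)
Let truncn_eq (f : R * R -> R) (f0 : forall x, 0 <= f x) (x : R * R) (k : nat) :
  Num.truncn (f x / t) = k <-> ~ f x < k%:R * t /\ f x < k%:R * t + t.
Proof.
have fE : (k%:R <= f x / t < k.+1%:R) = (~~ (f x < k%:R * t) && (f x < k%:R * t + t)).
  by rewrite ler_pdivlMr// ltr_pdivrMr// -natr1 mulrDl mul1r leNgt.
split => [<-|[/negP h1 h2]]; last by apply: truncn_def; rewrite fE h1 h2.
have : 0 <= f x / t by rewrite divr_ge0// ltW.
move=> /truncn_itv; rewrite ler_pdivlMr// ltr_pdivrMr// -natr1 mulrDl mul1r leNgt.
by move=> /andP[/negP].
Qed.

Let cellP n : cell n = set0 \/ exists i j : nat,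
  cell n = ann (i%:R * t) (i%:R * t + t) `&` slab (j%:R * t) (j%:R * t + t).
Proof.
have [->|/set0P[x0 <-]] := eqVneq (cell n) set0; first by left.
right; exists (Num.truncn (r x0 / t)), (Num.truncn (s x0 / t)).
apply/seteqP; split => x.
  move=> /(pcan_inj pickleK)[rx sx].
  split; first by have [] := (truncn_eq r_ge0 x _).1 rx.
  by have [] := (truncn_eq s_ge0 x _).1 sx.
move=> [[h1 h2] [h3 h4]]; rewrite /cell/= /idx.
by congr (pickle (_, _)); apply/truncn_eq.
Qed.

Let mcell n : measurable (cell n).
Proof.
have [->|[i [j ->]]] := cellP n; first exact: measurable0.
exact: measurableI.
Qed.

Let cell_partition (B : set (R * R)) : \bigcup_n (B `&` cell n) = B.
Proof. by apply/seteqP; split => [x [n _ []]//|x Bx]; exists (idx x). Qed.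

Let triv_cell (D : set Omega) (B : set (R * R)) :
  trivIset setT (fun n => D `&` X @^-1` (B `&` cell n)).
Proof. by move=> i j _ _ [w [[_ [_ <-]] [_ [_ <-]]]]. Qed.

Let prob_sum : P ([set w | X w = Y w] `&` X @^-1` Q) =
  (\sum_(n <oo) P ([set w | X w = Y w] `&` X @^-1` (Q `&` cell n)))%E.
Proof.
have mF n : measurable ([set w | X w = Y w] `&` X @^-1` (Q `&` cell n)).
  apply: measurableI; first exact: measurable_coincide.
  by apply: measurable_preimageT mX _; exact: measurableI.
rewrite -{1}(cell_partition Q) preimage_bigcup setI_bigcupr.
by rewrite measure_semi_bigcup//; exact: bigcup_measurable.
Qed.

Let integral_sum : (\int[P]_(w in X @^-1` Q') (void_prob (X w))%:E =
  \sum_(n <oo) \int[P]_(w in X @^-1` (Q' `&` cell n)) (void_prob (X w))%:E)%E.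
Proof.
rewrite -{1}(cell_partition Q') preimage_bigcup ge0_integral_bigcup//.
- by move=> n; apply: measurable_preimageT mX _; exact: measurableI.
- apply/measurable_EFinP; apply: measurable_funTS.
  exact: measurableT_comp measurable_void_prob mX.
- by move=> w _; rewrite lee_fin void_prob_ge0.
- by have := @triv_cell setT Q'; under eq_fun do rewrite setTI.
Qed.

Let cell_compare n :
  (P ([set w | X w = Y w] `&` X @^-1` (Q `&` cell n)) <=
   (expR (3 * lambda * (kappa * t)))%:E *
   \int[P]_(w in X @^-1` (Q' `&` cell n)) (void_prob (X w))%:E)%E /\
  (\int[P]_(w in X @^-1` (Q' `&` cell n)) (void_prob (X w))%:E <=
   (expR (3 * lambda * (kappa * t)))%:E *
   P ([set w | X w = Y w] `&` X @^-1` (Q `&` cell n)))%E.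
Proof.
have [->|[i [j cE]]] := cellP n.
  by rewrite !setI0 !preimage_set0 ?setI0 measure0 integral_set0 mule0.
have i0 : 0 <= i%:R * t by rewrite mulr_ge0// ltW.
have j0 : 0 <= j%:R * t by rewrite mulr_ge0// ltW.
have ab : i%:R * t <= i%:R * t + t by rewrite lerDl ltW.
have cE' B : B `&` cell n `<=` ann (i%:R * t) (i%:R * t + t).
  by rewrite cE => x [_ []].
have cE'' B : B `&` cell n `<=` slab (j%:R * t) (j%:R * t + t).
  by rewrite cE => x [_ []].
have mcQ : measurable (Q `&` cell n) by exact: measurableI.
have mcQ' : measurable (Q' `&` cell n) by exact: measurableI.
have QQ : rarea (Q `&` cell n) = rarea (Q' `&` cell n) by rewrite cE.
split.
  exact: (prob_le_integral_cell ab mcQ mcQ' (cE' _) (cE'' _) (cE' _) (cE'' _) QQ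
    (annle i0 (ltW t_gt0)) (slable j0 (ltW t_gt0))).
exact: (integral_le_prob_cell ab mcQ mcQ' (cE' _) (cE'' _) (cE' _) (cE'' _) QQ
    (annle i0 (ltW t_gt0)) (slable j0 (ltW t_gt0))).
Qed.

(** The factor is the same for all cells, so it comes out of the series. *)
Lemma grid_compare :
  (P ([set w | X w = Y w] `&` X @^-1` Q) <=
   (expR (3 * lambda * (kappa * t)))%:E *
   \int[P]_(w in X @^-1` Q') (void_prob (X w))%:E)%E /\
  (\int[P]_(w in X @^-1` Q') (void_prob (X w))%:E <=
   (expR (3 * lambda * (kappa * t)))%:E * P ([set w | X w = Y w] `&` X @^-1` Q))%E.
Proof.
have int0 n : (0 <= \int[P]_(w in X @^-1` (Q' `&` cell n)) (void_prob (X w))%:E)%E.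
  by apply: integral_ge0 => w _; rewrite lee_fin void_prob_ge0.
rewrite prob_sum integral_sum -!nneseriesZl//; split; apply: lee_nneseries => n *.
- exact: measure_ge0.
- exact: (cell_compare n).1.
- exact: int0.
- exact: (cell_compare n).2.
Qed.

End Grid.

Lemma ler_expR_factor (x y : R) : 0 <= y ->
  (forall e, 0 < e -> x <= expR e * y) -> x <= y.
Proof.
move=> y0 h; apply/ler_addgt0Pr => e e0.
have y1 : 0 < y + 1 by rewrite ltr_wpDl.
have q0 : 0 < e / (y + 1) by rewrite divr_gt0.
have q1 : 1 < 1 + e / (y + 1) by rewrite ltrDl.
(* The factor [1 + e / (y + 1)] raises [y] by at most [e]; the denominator is [y + 1] because [y]
   may be 0. *)
rewrite (le_trans (h _ (ln_gt0 q1)))// lnK ?posrE; last exact: lt_trans q1.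
rewrite mulrDl mul1r lerD2l -mulrA ger_pMr// mulrC ler_pdivrMr// mul1r.
by rewrite lerDl.
Qed.

Lemma prob_coincide_void :
  P ([set w | X w = Y w] `&` X @^-1` Q) =
  (\int[P]_(w in X @^-1` Q') (void_prob (X w))%:E)%E.
Proof.
set p := P _; set I := (\int[_]_(_ in _) _)%E.
have I0 : (0 <= I)%E.
  by apply: integral_ge0 => w _; rewrite lee_fin void_prob_ge0.
have p0 : (0 <= p)%E by exact: measure_ge0.
have pfin : p \is a fin_num.
  apply: fin_num_measure; apply: measurableI; first exact: measurable_coincide.
  exact: measurable_preimageT mX mQ.
have Ifin : I \is a fin_num.
  rewrite ge0_fin_numE//; apply: le_lt_trans (grid_compare ltr01).2 _.
  by rewrite -[X in (_ * X)%E](fineK pfin) -EFinM ltry.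
have lk0 : 0 < 3 * lambda * kappa by rewrite !mulr_gt0.
have grid e : 0 < e -> (p <= (expR e)%:E * I)%E /\ (I <= (expR e)%:E * p)%E.
  move=> e0; have t0 : 0 < e / (3 * lambda * kappa) by rewrite divr_gt0.
  have := grid_compare t0.
  rewrite (_ : 3 * lambda * _ = e)//; field.
  by rewrite !gt_eqF.
apply/eqP; rewrite eq_le -(fineK pfin) -(fineK Ifin) !lee_fin.
apply/andP; split; apply: ler_expR_factor; rewrite ?fine_ge0// => e /grid[h1 h2].
  by rewrite -lee_fin EFinM !fineK.
by rewrite -lee_fin EFinM !fineK.
Qed.

End CoincidingMinimizers.

(** * Frame coordinates and polar angle *)

Section Geometry.
Context {R : realType}.

Lemma frame_coords_enorm (xs xd x : R * R) : xs <> xd ->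
  enorm (x - midpoint xs xd) ^+ 2 =
  (frame_coords xs xd x).1 ^+ 2 + (frame_coords xs xd x).2 ^+ 2.
Proof.
move=> xsd; have d0 := half_dist_gt0 xsd; have d2 : half_dist xs xd ^+ 2 != 0.
  by rewrite gt_eqF// exprn_gt0.
rewrite enormK /frame_coords /= !expr_div_n -mulrDl; apply: (mulIf d2); rewrite divfK//.
by rewrite enormK /=; field.
Qed.

Lemma shatK (xs xd x : R * R) :
  shat xs xd x ^+ 2 = Num.max (enorm (x - xs) ^+ 2) (enorm (x - xd) ^+ 2).
Proof.
have -> : enorm (x - xs) = enorm (xs - x) by congr Num.sqrt; rewrite /=; ring.
rewrite /shat; have [h|h] := leP (enorm (xs - x)) (enorm (x - xd)).
  by rewrite max_r// ler_pXn2r// nnegrE enorm_ge0.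
by rewrite max_l// ler_pXn2r// ?nnegrE ?enorm_ge0// ltW.
Qed.

(** In the frame the squared distances to the two ends differ only in the sign of [2 * d * y.1];
    their maximum turns it into an absolute value. *)
Lemma frame_coords_shat (xs xd x : R * R) : xs <> xd ->
  shat xs xd x ^+ 2 =
  (frame_coords xs xd x).1 ^+ 2 + (frame_coords xs xd x).2 ^+ 2
  + half_dist xs xd ^+ 2 + 2 * half_dist xs xd * `|(frame_coords xs xd x).1|.
Proof.
move=> xsd; have d0 := half_dist_gt0 xsd.
have dn : half_dist xs xd != 0 by rewrite gt_eqF.
set y := frame_coords xs xd x; set d := half_dist xs xd in d0 dn *.
have dy : d * y.1 = (x - midpoint xs xd).1 * (xd - midpoint xs xd).1
    + (x - midpoint xs xd).2 * (xd - midpoint xs xd).2.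
  by rewrite /y /frame_coords /= -/d mulrC divfK.
have d2 : d ^+ 2 =
    (xs - midpoint xs xd).1 ^+ 2 + (xs - midpoint xs xd).2 ^+ 2 by rewrite enormK.
have hs : enorm (x - xs) ^+ 2 = y.1 ^+ 2 + y.2 ^+ 2 + d ^+ 2 + 2 * d * y.1.
  by rewrite -frame_coords_enorm// -mulrA dy d2 !enormK /=; field.
have hd : enorm (x - xd) ^+ 2 = y.1 ^+ 2 + y.2 ^+ 2 + d ^+ 2 - 2 * d * y.1.
  by rewrite -frame_coords_enorm// -mulrA dy d2 !enormK /=; field.
rewrite shatK hs hd; have [y0|y0] := leP 0 y.1.
  have dy0 : 0 <= d * y.1 by rewrite mulr_ge0// ltW.
  by rewrite ger0_norm// max_l// -!mulrA; lra.
have dy0 : d * y.1 < 0 by rewrite pmulr_rlt0.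
by rewrite ltr0_norm// max_r -!mulrA ?mulrN//; lra.
Qed.

Lemma frame_coords0 (xs xd x : R * R) : xs <> xd ->
  x <> midpoint xs xd ->
  0 < (frame_coords xs xd x).1 ^+ 2 + (frame_coords xs xd x).2 ^+ 2.
Proof.
move=> xsd xm; rewrite -frame_coords_enorm// lt_neqAle sqr_ge0 andbT eq_sym.
apply/eqP; rewrite enormK => /eqP; rewrite paddr_eq0 ?sqr_ge0// !sqrf_eq0 /=.
by move=> /andP[/eqP h1 /eqP h2]; apply: xm; apply: injective_projections => /=; lra.
Qed.

Lemma polar_coords_exists (c s : R) : c ^+ 2 + s ^+ 2 = 1 ->
  exists2 t : R, 0 <= t < 2 * pi & (c, s) = (cos t, sin t).
Proof.
move=> cs1; have c1 : -1 <= c <= 1.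
  rewrite -ler_norml -(ler_pXn2r (ltn0Sn 1)) ?nnegrE// expr1n.
  by rewrite real_normK ?num_real// -cs1 lerDl sqr_ge0.
have sE : sin (acos c) = `|s|.
  by rewrite sin_acos// -cs1 [X in X - _]addrC addrK sqrtr_sqr.
have pi0 := pi_gt0 R; have ac0 := acos_ge0 c1; have acpi := acos_lepi c1.
have [s0|s0] := leP 0 s.
  exists (acos c); first by apply/andP; split; lra.
  by rewrite acosK ?in_itv// sE ger0_norm.
exists (2 * pi - acos c).
  apply/andP; split; first by lra.
  (* [acos c = 0] would force [s = 0]; the angle thus stays strictly below [2 * pi]. *)
  rewrite gtrBl lt_neqAle ac0 andbT eq_sym; apply/eqP => a0.
  by move: sE; rewrite a0 sin0 => /esym/normr0P/eqP s00; rewrite s00 ltxx in s0.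
have -> : 2 * pi = pi *+ 2 :> R by rewrite mulr_natl.
by rewrite addrC cosD2pi sinD2pi cosN sinN acosK ?in_itv// sE ltr0_norm// opprK.
Qed.

(** Since [polar_angle] is chosen by [get], the existence of an admissible angle is enough. *)
Lemma polar_angleP (xs xd x : R * R) : xs <> xd -> x <> midpoint xs xd ->
  0 <= polar_angle xs xd x < 2 * pi /\
  frame_coords xs xd x = (polar_norm xs xd x * cos (polar_angle xs xd x),
    polar_norm xs xd x * sin (polar_angle xs xd x)).
Proof.
move=> xsd xm; apply: (@getPex _ [set t | 0 <= t < 2 * pi /\
    frame_coords xs xd x =
      (polar_norm xs xd x * cos t, polar_norm xs xd x * sin t)]).
have := frame_coords0 xsd xm; rewrite -frame_coords_enorm// -/(polar_norm xs xd x).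
set psi := polar_norm _ _ _ => psi20; set y := frame_coords _ _ _.
have psi0 : psi != 0 by apply: contraTneq psi20 => ->; rewrite expr0n/= ltxx.
have unit_vec (y1 y2 p : R) : p != 0 -> y1 ^+ 2 + y2 ^+ 2 = p ^+ 2 ->
    (y1 / p) ^+ 2 + (y2 / p) ^+ 2 = 1.
  by move=> p0 h; rewrite !expr_div_n -mulrDl h divff// expf_neq0.
have [t t0 [ct st]] := polar_coords_exists
  (unit_vec _ _ _ psi0 (esym (frame_coords_enorm x xsd))).
have mulK (z : R) : psi * (z / psi) = z by rewrite mulrC divfK.
by exists t; split => //; rewrite -ct -st !mulK; exact: surjective_pairing.
Qed.

Lemma polar_angle_first_quadrant (xs xd x : R * R) : xs <> xd -> x <> midpoint xs xd ->
  (0 <= polar_angle xs xd x <= pi / 2) =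
  (0 <= (frame_coords xs xd x).1) && (0 <= (frame_coords xs xd x).2).
Proof.
move=> xsd xm; have [/andP[t0 t2pi] ->] := polar_angleP xsd xm.
have psi0 : 0 < polar_norm xs xd x.
  rewrite lt_neqAle enorm_ge0 andbT eq_sym; apply: contraTneq (frame_coords0 xsd xm).
  by rewrite -frame_coords_enorm// -/(polar_norm xs xd x) => ->; rewrite expr0n/= ltxx.
set t := polar_angle _ _ _ in t0 t2pi *.
rewrite /= !pmulr_rge0// t0 /=; have pi0 := pi_gt0 R.
have [tp|tp] := leP t (pi / 2).
  rewrite cos_ge0_pihalf ?sin_ge0_pi//; apply/andP; split; lra.
have [tpi|tpi] := leP t pi.
  have : 0 < sin (t - pi / 2).
    by rewrite sin_gt0_pi//; apply/andP; split; lra.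
  by rewrite sinBpihalf oppr_gt0 ltNge => /negbTE ->.
have : 0 < sin (t - pi) by rewrite sin_gt0_pi//; apply/andP; split; lra.
rewrite sinB cospi sinpi mulr0 subr0 mulrN1 oppr_gt0 ltNge => /negbTE ->.
by rewrite andbF.
Qed.

End Geometry.

(** * Symmetries and the main formula *)

Section Areas.
Context {R : realType}.

Lemma measurable_disc (p : R * R) (r : R) :
  measurable [set x : R * R | (x.1 - p.1) ^+ 2 + (x.2 - p.2) ^+ 2 < r].
Proof.
apply: measurable_set_ltr => //.
by apply: measurable_funD; apply: measurable_funX; exact: measurable_funB.
Qed.

Lemma rarea_annulus (p : R * R) (a t : R) : 0 <= a -> 0 <= t ->
  rarea ([set x | enorm (x - p) ^+ 2 < a + t] `\` [set x | enorm (x - p) ^+ 2 < a]) =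
  pi * t.
Proof.
move=> a0 t0; pose D r := [set x : R * R | (x.1 - p.1) ^+ 2 + (x.2 - p.2) ^+ 2 < r].
have E r : [set x | enorm (x - p) ^+ 2 < r] = D r.
  by apply/funext => x; rewrite /= enormK.
have Da : area (D a) = (pi * a)%:E := area_disc p a0.
have Dat : area (D (a + t)) = (pi * (a + t))%:E := area_disc p (addr_ge0 a0 t0).
have fin : (area (D (a + t)%R) < +oo)%E by rewrite Dat ltry.
rewrite /rarea !E (measureD (measurable_disc p (a + t)) (measurable_disc p a) fin).
rewrite setIidr; last by move=> x /lt_le_trans; apply; rewrite lerDl.
transitivity (fine (area (D (a + t)%R) - area (D a))%E) => //.
by rewrite Da Dat -EFinB /=; ring.
Qed.

Lemma area_line1 (c : R) : area [set x : R * R | x.1 = c] = 0%E.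
Proof.
rewrite areaE2; last exact: measurable_set_eqr.
apply: integral0_eq => y _; rewrite -(lebesgue_measure_set1 c); congr lebesgue_measure.
by apply/seteqP; split => x /=; rewrite /ysection/= inE.
Qed.

Lemma area_line2 (c : R) : area [set x : R * R | x.2 = c] = 0%E.
Proof.
rewrite areaE; apply: integral0_eq => y _.
rewrite -(lebesgue_measure_set1 c); congr lebesgue_measure.
by apply/seteqP; split => x /=; rewrite /xsection/= inE.
Qed.

(** Reflection carries one open half to the other; the axis, of area 0, makes up the difference. *)
Lemma area_half1 (S : set (R * R)) : measurable S ->
  (forall x y, S (- x, y) <-> S (x, y)) ->
  area (S `&` [set x | x.1 < 0]) = area (S `&` [set x | 0 <= x.1]).
Proof.
move=> mS sym.
have mneg : measurable (S `&` [set x | x.1 < 0]).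
  by apply: measurableI => //; exact: measurable_set_ltr.
rewrite -(area_Nfst mneg); apply: measure_setU_null (area_line1 0) _ _.
- apply: measurable_preimageT mneg; apply: measurable_fun_pair => //.
  exact: measurable_funN.
- by apply: measurableI => //; exact: measurable_set_ler.
- exact: measurable_set_eqr.
- by move=> [x y] /= [/sym Sx]; rewrite oppr_lt0 => /ltW.
- move=> [x y] /= [Sx]; rewrite le_eqVlt => /predU1P[<-|x0]; [by right|left].
  by split; [exact/sym|rewrite oppr_lt0].
Qed.

Lemma area_half2 (S : set (R * R)) : measurable S ->
  (forall x y, S (x, - y) <-> S (x, y)) ->
  area (S `&` [set x | x.2 < 0]) = area (S `&` [set x | 0 <= x.2]).
Proof.
move=> mS sym.
have mneg : measurable (S `&` [set x | x.2 < 0]).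
  by apply: measurableI => //; exact: measurable_set_ltr.
rewrite -(area_Nsnd mneg); apply: measure_setU_null (area_line2 0) _ _.
- apply: measurable_preimageT mneg; apply: measurable_fun_pair => //.
  exact: measurable_funN.
- by apply: measurableI => //; exact: measurable_set_ler.
- exact: measurable_set_eqr.
- by move=> [x y] /= [/sym Sx]; rewrite oppr_lt0 => /ltW.
- move=> [x y] /= [Sx]; rewrite le_eqVlt => /predU1P[<-|x0]; [by right|left].
  by split; [exact/sym|rewrite oppr_lt0].
Qed.

Lemma measurable_singleton (p : R * R) : measurable [set p].
Proof.
rewrite (_ : [set p] = [set x | x.1 = p.1] `&` [set x | x.2 = p.2]).
  by apply: measurableI; exact: measurable_set_eqr.
by apply/seteqP; split => x /=; [move=> ->|case=> *; exact: injective_projections].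
Qed.

Lemma rarea_singleton (p : R * R) : rarea [set p] = 0.
Proof.
suff A0 : area [set p] = 0%E by rewrite /rarea A0.
apply/eqP; rewrite eq_le measure_ge0 andbT -(area_line1 p.1).
apply: le_measure; [by apply/mem_set; exact: measurable_singleton| |by move=> x ->].
by apply/mem_set; exact: measurable_set_eqr.
Qed.

(** Axes go to the nonnegative side: the four sets partition the plane, and the closed one,
    [quadrant false false], matches the angles in [0, pi / 2]. *)
Definition quadrant (b1 b2 : bool) : set (R * R) :=
  [set x | ((x.1 < 0) = b1) /\ ((x.2 < 0) = b2)].

Lemma measurable_set_ltr0 (b : bool) (f : R * R -> R) :
  measurable_fun setT f -> measurable [set x | (f x < 0) = b].
Proof.
move=> mf; case: b; first exact: measurable_set_ltr.
rewrite [X in measurable X](_ : _ = [set x | 0 <= f x]).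
  exact: measurable_set_ler.
by apply/funext => x /=; rewrite leNgt; apply/propext; split => [->//|/negbTE].
Qed.

Lemma measurable_quadrant b1 b2 : measurable (quadrant b1 b2).
Proof. by apply: measurableI; exact: measurable_set_ltr0. Qed.

Lemma area_quadrant (S : set (R * R)) (b1 b2 : bool) : measurable S ->
  (forall x y, S (- x, y) <-> S (x, y)) -> (forall x y, S (x, - y) <-> S (x, y)) ->
  area (quadrant b1 b2 `&` S) = area (quadrant false false `&` S).
Proof.
move=> mS sym1 sym2.
have ge0E (z : R) : ((z < 0) = false) = (0 <= z) :> Prop.
  by rewrite leNgt; apply/propext; split => [->//|/negbTE].
have flip1 b : area (quadrant true b `&` S) = area (quadrant false b `&` S).
  rewrite (_ : quadrant true b `&` S =
      S `&` [set x | (x.2 < 0) = b] `&` [set x | x.1 < 0]); last first.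
    by apply/seteqP; split => x /= => [[[? ?] ?]|[[? ?] ?]].
  rewrite area_half1; last 2 first.
  - by apply: measurableI => //; exact: measurable_set_ltr0.
  - by move=> x y /=; rewrite sym1.
  congr area; apply/seteqP; split => x /=; rewrite /quadrant /= ge0E.
    by move=> [[? ?] ?].
  by move=> [[? ?] ?].
have flip2 : area (quadrant false true `&` S) = area (quadrant false false `&` S).
  rewrite (_ : quadrant false true `&` S =
      S `&` [set x | (x.1 < 0) = false] `&` [set x | x.2 < 0]); last first.
    by apply/seteqP; split => x /= => [[[? ?] ?]|[[? ?] ?]].
  rewrite area_half2; last 2 first.
  - by apply: measurableI => //; exact: measurable_set_ltr0.
  - by move=> x y /=; rewrite sym2.
  congr area; apply/seteqP; split => x /=; rewrite /quadrant /= !ge0E.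
    by move=> [[? ?] ?].
  by move=> [[? ?] ?].
case: b1; case: b2; [rewrite flip1; exact: flip2|exact: flip1|exact: flip2|].
exact: erefl.
Qed.

End Areas.

(** * Areas of annuli, slabs and voided regions through frame coordinates *)

Section Frame.
Context {R : realType}.
Variables xs xd : R * R.
Hypothesis xsd : xs <> xd.

Let T := frame_coords xs xd.
Let d := half_dist xs xd.
Let r (x : R * R) := enorm (x - midpoint xs xd) ^+ 2.
Let s (x : R * R) := shat xs xd x ^+ 2.

Lemma measurable_sqr_enorm (p : R * R) :
  measurable_fun setT (fun x : R * R => enorm (x - p) ^+ 2).
Proof.
have -> : (fun x : R * R => enorm (x - p) ^+ 2) =
    (fun x : R * R => (x.1 - p.1) ^+ 2 + (x.2 - p.2) ^+ 2).
  by apply/funext => x; rewrite enormK.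
by apply: measurable_funD; apply: measurable_funX; exact: measurable_funB.
Qed.

Lemma measurable_sqr_shat : measurable_fun setT s.
Proof.
have -> : s = (fun x : R * R => Num.max (enorm (x - xs) ^+ 2) (enorm (x - xd) ^+ 2)).
  by apply/funext => x; rewrite /s shatK.
by apply: measurable_maxr; exact: measurable_sqr_enorm.
Qed.

Lemma bounded_enorm (p : R * R) (a : R) : bounded_set [set x | enorm (x - p) ^+ 2 < a].
Proof. by apply: bounded_setW (bounded_disc p a) => x /=; rewrite enormK. Qed.

Lemma bounded_shat (a : R) : bounded_set [set x | s x < a].
Proof.
by apply: bounded_setW (bounded_enorm xs a) => x; rewrite /s /= shatK gt_max => /andP[].
Qed.

(** Where the larger of the two squared distances is in [a, a + t), the end attaining it has the
    point in its own annulus of area [pi * t]. *)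
Lemma rarea_shat_slab (a t : R) : 0 <= a -> 0 <= t ->
  rarea ([set x | s x < a + t] `\` [set x | s x < a]) <= 2 * pi * t.
Proof.
move=> a0 t0; rewrite -mulrA mulr_natl mulr2n.
rewrite -{1}(rarea_annulus xs a0 t0) -(rarea_annulus xd a0 t0).
have mlt (p : R * R) (b : R) : measurable [set x | enorm (x - p) ^+ 2 < b].
  by apply: measurable_set_ltr => //; exact: measurable_sqr_enorm.
have blt (p : R * R) (b c : R) : bounded_set
    ([set x | enorm (x - p) ^+ 2 < b] `\` [set x | enorm (x - p) ^+ 2 < c]).
  by apply: bounded_setW (bounded_enorm p b) => x [].
apply: le_rareaU.
- by apply: measurableD; apply: measurable_set_ltr => //; exact: measurable_sqr_shat.
- exact: measurableD.
- exact: measurableD.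
- exact: blt.
- exact: blt.
move=> x /=; rewrite /s shatK !gt_max => -[/andP[h1 h2] /negP].
by rewrite negb_and => /orP[|] /negP h; [left|right].
Qed.

(** In the frame, [r] and [s] are even in each coordinate, so their level sets meet all quadrants in
    equal areas. *)
Lemma rarea_quadrant (a b u v : R) (b1 b2 : bool) :
  let S := ([set x | r x < b] `\` [set x | r x < a]) `&`
    ([set x | s x < v] `\` [set x | s x < u]) in
  rarea (T @^-1` quadrant b1 b2 `&` S) = rarea (T @^-1` quadrant false false `&` S).
Proof.
pose r0 (y : R * R) := y.1 ^+ 2 + y.2 ^+ 2.
pose s0 (y : R * R) := y.1 ^+ 2 + y.2 ^+ 2 + d ^+ 2 + 2 * d * `|y.1|.
pose S0 := ([set x | r0 x < b] `\` [set x | r0 x < a]) `&`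
  ([set x | s0 x < v] `\` [set x | s0 x < u]).
move=> S; have SE : S = T @^-1` S0.
  apply/funext => x; rewrite /S /S0 /= /setI /setD /mkset /=.
  by rewrite /r /s !(frame_coords_enorm _ xsd) !(frame_coords_shat _ xsd).
have mr0 : measurable_fun setT r0.
  by apply: measurable_funD; apply: measurable_funX.
have ms0 : measurable_fun setT s0.
  apply: measurable_funD; first exact: measurable_funD.
  by apply: measurable_funM => //; exact: measurableT_comp.
have mS0 : measurable S0.
  by apply: measurableI; apply: measurableD; exact: measurable_set_ltr.
have sym1 x y : S0 (- x, y) <-> S0 (x, y).
  by rewrite /S0 /setI /setD /mkset /= /r0 /s0 /= !sqrrN !normrN.
have sym2 x y : S0 (x, - y) <-> S0 (x, y).
  by rewrite /S0 /setI /setD /mkset /= /r0 /s0 /= !sqrrN.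
have mQS b1' b2' : measurable (quadrant b1' b2' `&` S0).
  by apply: measurableI => //; exact: measurable_quadrant.
rewrite /rarea SE -!preimage_setI; congr fine.
rewrite (area_frame_coords xsd (mQS b1 b2)).
rewrite (area_frame_coords xsd (mQS false false)).
exact: area_quadrant.
Qed.

Lemma rarea_voided (x : R * R) : x <> midpoint xs xd ->
  0 <= polar_angle xs xd x <= pi / 2 -> rarea (voided r s x) = P_fun xs xd x.
Proof.
move=> xm thP; have [_ Tx] := polar_angleP xsd xm.
have psi0 : 0 < polar_norm xs xd x.
  rewrite lt_neqAle enorm_ge0 andbT eq_sym; apply: contraTneq (frame_coords0 xsd xm).
  rewrite -(frame_coords_enorm _ xsd) -/(polar_norm xs xd x) => ->.
  by rewrite expr0n/= ltxx.
have d0 : 0 < d := half_dist_gt0 xsd.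
have /andP[p0 q0] : (0 <= (T x).1) && (0 <= (T x).2).
  by rewrite -(polar_angle_first_quadrant xsd xm).
have sE : shat xs xd x = Num.sqrt (((T x).1 + d) ^+ 2 + (T x).2 ^+ 2).
  have s_ge0 : 0 <= shat xs xd x by rewrite le_max enorm_ge0.
  rewrite -[LHS]ger0_norm// -sqrtr_sqr (frame_coords_shat _ xsd) -/T -/d ger0_norm//.
  by congr Num.sqrt; ring.
have psiE : polar_norm xs xd x = Num.sqrt ((T x).1 ^+ 2 + (T x).2 ^+ 2).
  by rewrite -(frame_coords_enorm _ xsd) sqrtr_sqr ger0_norm// enorm_ge0.
have -> : voided r s x = T @^-1` [set y : R * R |
    y.1 ^+ 2 + y.2 ^+ 2 + d ^+ 2 + 2 * d * `|y.1| < shat xs xd x ^+ 2 /\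
    polar_norm xs xd x ^+ 2 <= y.1 ^+ 2 + y.2 ^+ 2].
  apply/funext => y; rewrite /voided /= /r /s.
  by rewrite (frame_coords_shat y xsd) (frame_coords_enorm y xsd).
rewrite /rarea area_frame_coords//; last first.
  have mr0 : measurable_fun setT (fun y : R * R => y.1 ^+ 2 + y.2 ^+ 2).
    by apply: measurable_funD; apply: measurable_funX.
  apply: measurableI; last exact: measurable_set_ler.
  apply: measurable_set_ltr => //.
  apply: measurable_funD; first exact: measurable_funD.
  by apply: measurable_funM => //; exact: measurableT_comp.
rewrite sE psiE area_crescent//; last exact: frame_coords0.
rewrite -sE -psiE /P_fun /V_fun -/d.
have T1 : (T x).1 = polar_norm xs xd x * cos (polar_angle xs xd x) by rewrite /T Tx.
have T2 : (T x).2 = polar_norm xs xd x * sin (polar_angle xs xd x) by rewrite /T Tx.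
have := crescent_polarE d0 psi0 thP; cbv zeta; rewrite -T1 -T2 -sE => cE.
exact: cE.
Qed.

End Frame.

Theorem theorem3 (R : realType) (disp : measure_display)
    (Omega : measurableType disp) (P : probability Omega R)
    (lambda : R) (Phi : Omega -> set (R * R)) (xs xd : R * R)
    (Xmid Xopt : Omega -> R * R)
    (lambda_gt0 : 0 < lambda)
    (PhiPPP : homogeneous_PPP P lambda Phi)
    (xs_neq_xd : xs <> xd)
    (Xmid_meas : measurable_fun [set: Omega] Xmid)
    (Xopt_meas : measurable_fun [set: Omega] Xopt)
    (XmidE : {ae P, forall omega,
      is_argmin (fun x => enorm (x - midpoint xs xd)) (Phi omega) (Xmid omega)})
    (XoptE : {ae P, forall omega,
      is_argmin (shat xs xd) (Phi omega) (Xopt omega)}) :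
  P [set omega | Xmid omega = Xopt omega] =
  (4%:E * 'E_P[fun omega => (expR (- lambda * P_fun xs xd (Xmid omega))
     * \1_[set o | 0 <= polar_angle xs xd (Xmid o) <= pi / 2] omega)%R])%E.
Proof.
pose w := midpoint xs xd; pose T := frame_coords xs xd.
pose r (x : R * R) := enorm (x - w) ^+ 2; pose s (x : R * R) := shat xs xd x ^+ 2.
have shat_ge0 x : 0 <= shat xs xd x by rewrite le_max enorm_ge0.
have rE : {ae P, forall omega, is_argmin r (Phi omega) (Xmid omega)}.
  apply: filterS XmidE => o [PX Xmin]; split => // y /Xmin Xy.
  by rewrite /r ler_pXn2r ?nnegrE ?enorm_ge0.
have sE : {ae P, forall omega, is_argmin s (Phi omega) (Xopt omega)}.
  apply: filterS XoptE => o [PX Xmin]; split => // y /Xmin Xy.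
  by rewrite /s ler_pXn2r ?nnegrE ?shat_ge0.
have mr : measurable_fun setT r by exact: measurable_sqr_enorm.
have ms : measurable_fun setT s by exact: measurable_sqr_shat.
have br a : bounded_set [set x | r x < a] by exact: bounded_enorm.
have bs a : bounded_set [set x | s x < a] by exact: bounded_shat.
have pi0 : 0 < pi :> R := pi_gt0 R.
have kappa0 : 0 < 2 * pi :> R by rewrite mulr_gt0.
have annle a t : 0 <= a -> 0 <= t ->
    rarea ([set x | r x < a + t] `\` [set x | r x < a]) <= 2 * pi * t.
  move=> a0 t0; rewrite (rarea_annulus w a0 t0).
  have : 0 <= pi * t by rewrite mulr_ge0// ltW.
  lra.
have mQ b1 b2 : measurable (T @^-1` quadrant b1 b2).
  apply: measurable_preimageT (measurable_frame_coords xs xd) _.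
  exact: measurable_quadrant.
pose I := (\int[P]_(o in Xmid @^-1` (T @^-1` quadrant false false))
  (void_prob lambda r s (Xmid o))%:E)%E.
have main b1 b2 :
    P ([set o | Xmid o = Xopt o] `&` Xmid @^-1` (T @^-1` quadrant b1 b2)) = I.
  apply: (prob_coincide_void lambda_gt0 PhiPPP mr ms br bs Xmid_meas Xopt_meas
    rE sE _ _ kappa0 annle _ (mQ b1 b2) (mQ false false)).
  - by move=> x; exact: sqr_ge0.
  - by move=> x; exact: sqr_ge0.
  - by move=> a t; exact: rarea_shat_slab.
  - by move=> a b u v; exact: rarea_quadrant.
have mXQ (Q : set (R * R)) : measurable Q -> measurable (Xmid @^-1` Q).
  exact: measurable_preimageT.
have mE : measurable [set o | Xmid o = Xopt o] by exact: measurable_coincide.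
have -> : P [set o | Xmid o = Xopt o] = (4%:E * I)%E.
  have mH1 : measurable (Xmid @^-1` (T @^-1` [set y | y.1 < 0])).
    apply: mXQ; apply: measurable_preimageT (measurable_frame_coords xs xd) _.
    exact: measurable_set_ltr.
  have mH2 : measurable (Xmid @^-1` (T @^-1` [set y | y.2 < 0])).
    apply: mXQ; apply: measurable_preimageT (measurable_frame_coords xs xd) _.
    exact: measurable_set_ltr.
  have Ifin : I \is a fin_num.
    rewrite -(main false false) fin_num_measure//.
    by apply: measurableI => //; exact: mXQ.
  have P4 (A1 A2 A3 A4 : set Omega) : P A1 = I -> P A2 = I -> P A3 = I -> P A4 = I ->
      (P A1 + P A2 + (P A3 + P A4) = 4%:E * I)%E.
    by move=> -> -> -> ->; rewrite -(fineK Ifin) -!EFinD -EFinM; congr (_ %:E); ring.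
  rewrite (measureDI P mE mH1) (measureDI P (measurableD mE mH1) mH2).
  rewrite (measureDI P (measurableI _ _ mE mH1) mH2).
  apply: P4; [rewrite -(main false false)|rewrite -(main false true)|
    rewrite -(main true false)|rewrite -(main true true)]; congr (P _); apply/seteqP;
    split => o /=.
  - by move=> [[? /negP/negbTE ?] /negP/negbTE ?].
  - by move=> [? [-> ->]].
  - by move=> [[? /negP/negbTE ?] ?].
  - by move=> [? [-> ->]].
  - by move=> [[? ?] /negP/negbTE ?].
  - by move=> [? [-> ->]].
  - by move=> [[? ?] ?].
  - by move=> [? [-> ->]].
congr (_ * _)%E; rewrite unlock /I integral_mkcond epatch_indic.
set A := [set o | _]; set Q := Xmid @^-1` _.
have mQ' : measurable Q by exact: mXQ.
pose g o : R := void_prob lambda r s (Xmid o) * \1_Q o.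
have mg : measurable_fun setT g.
  apply: measurable_funM; last exact: measurable_indic.
  by apply: measurableT_comp Xmid_meas; exact: measurable_void_prob.
(* At the midpoint the integrand takes some constant value [c0], the angle being unspecified;
   elsewhere it equals [g]. This also yields its measurability without that of [polar_angle]. *)
pose c0 : R := expR (- lambda * P_fun xs xd w)
  * \1_[set x | 0 <= polar_angle xs xd x <= pi / 2] w.
have fE o : expR (- lambda * P_fun xs xd (Xmid o)) * \1_A o =
    if Xmid o == w then c0 else g o.
  case: eqP => [Xw|Xw]; first by rewrite /A /c0 !indicE /= -Xw.
  have AQ : (o \in A) = (o \in Q).
    have := polar_angle_first_quadrant xs_neq_xd Xw => AE.
    apply/idP/idP => /set_mem; rewrite /A /Q /quadrant /=.
      rewrite AE => /andP[h1 h2]; apply/mem_set => /=.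
      by rewrite /quadrant/= !ltNge h1 h2.
    by move=> [/negbT h1 /negbT h2]; apply/mem_set; rewrite /= AE !leNgt h1 h2.
  rewrite /g !indicE AQ; case: (boolP (o \in Q)) => [oQ|_]; last by rewrite !mulr0.
  move: oQ; rewrite -AQ => /set_mem oA.
  by rewrite /void_prob (rarea_voided xs_neq_xd Xw oA) mulNr.
have mN : measurable (Xmid @^-1` [set w]) by apply: mXQ; exact: measurable_singleton.
have PN0 : P (Xmid @^-1` [set w]) = 0%E.
  apply/eqP; rewrite eq_le measure_ge0 andbT.
  have rw : r w = 0.
    by rewrite /r subrr enormK /= expr0n /= addr0.
  (* The midpoint alone is a cell part of area 0 inside {0 <= r < 1}, so the bound is
     [1 - expR 0 = 0]. *)
  have := @prob_cell_le _ _ _ P lambda Phi lambda_gt0 PhiPPP r Xmid mr br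
    Xmid_meas rE 0 1 [set w].
  rewrite rarea_singleton mulr0 oppr0 expR0 subrr mulr0.
  apply; first exact: measurable_singleton.
  by move=> x ->; rewrite /= rw ltr01 ltxx.
apply: ae_eq_integral => //.
- by apply/measurable_EFinP; exact: mg.
- apply/measurable_EFinP.
  under eq_fun do rewrite fE.
  apply: measurable_fun_ifT => //; apply: (measurable_fun_bool true).
  rewrite setTI (_ : _ @^-1` _ = Xmid @^-1` [set w])//.
  by apply/seteqP; split => o /= /eqP.
- exists (Xmid @^-1` [set w]); split => // o /= h.
  apply: contrapT => ow; apply: h => _; rewrite fE.
  by case: eqP ow.
Qed.
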